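(* Let a two-person zero-sum game $\{\mathbb{A},\mathbb{B},c\}$ satisfy: (a) the function $(b,a)\mapsto c(a,b)$ is $\mathbb{K}$-inf-compact on $\mathbb{B}\times\mathbb{A}$; (b) the function $(a,b)\mapsto c(a,b)$ is $\mathbb{K}$-sup-compact on $\mathbb{A}\times\mathbb{B}$; (c) the function $(a,b)\mapsto c(a,b)$ is bounded from below on $\mathbb{A}\times\mathbb{B}$. Then, with $v$ denoting the lopsided value of the game (which exists under these hypotheses), the following hold: (i) the game has a solution $(\pi^{\mathbb A},\pi^{\mathbb B})\in\mathbb{P}^\sharp_v(\mathbb{A})\times\mathbb{P}^\flat_v(\mathbb{B})$; (ii) the sets $\mathbb{P}^\sharp_v(\mathbb{A})$ and $\mathbb{P}^\flat_v(\mathbb{B})$ are nonempty convex compact subsets of $\mathbb{P}(\mathbb{A})$ and $\mathbb{P}(\mathbb{B})$ respectively; (iii) a pair of strategies $(\pi^{\mathbb A},\pi^{\mathbb B})\in\mathbb{P}(\mathbb{A})\times\mathbb{P}(\mathbb{B})$ is a solution of the game if and only if $\pi^{\mathbb A}\in\mathbb{P}^\sharp_v(\mathbb{A})$ and $\pi^{\mathbb B}\in\mathbb{P}^\flat_v(\mathbb{B})$.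
   Context: A two-person zero-sum game is a triplet $\{\mathbb{A},\mathbb{B},c\}$ where $\mathbb{A}$ and $\mathbb{B}$ are nonempty Borel subsets of Polish spaces, $c:\mathbb{A}\times\mathbb{B}\to\mathbb{R}$ is Borel measurable, for each $b\in\mathbb{B}$ the function $a\mapsto c(a,b)$ is bounded from below on $\mathbb{A}$, and for each $a\in\mathbb{A}$ the function $b\mapsto c(a,b)$ is bounded from above on $\mathbb{B}$. For metric spaces $U,V$, a function $g:U\times V\to\mathbb{R}\cup\{\pm\infty\}$ is $\mathbb{K}$-inf-compact on $U\times V$ if for every nonempty compact $C\subset U$ and every $\lambda\in\mathbb{R}$ the set $\{(u,y)\in C\times V:g(u,y)\le\lambda\}$ is compact; $g$ is $\mathbb{K}$-sup-compact if $-g$ is $\mathbb{K}$-inf-compact. (The order of the factors matters.) $\mathbb{P}(E)$ is the set of Borel probability measures on $E$ with the topology of weak convergence. With $c^+=\max\{c,0\}$, $c^-=\min\{c,0\}$, set $\hat c^{\oplus}(\pi^{\mathbb A},\pi^{\mathbb B})=\int_{\mathbb A}\int_{\mathbb B}c^+\,d\pi^{\mathbb B}d\pi^{\mathbb A}$, $\hat c^{\ominus}(\pi^{\mathbb A},\pi^{\mathbb B})=\int_{\mathbb A}\int_{\mathbb B}c^-\,d\pi^{\mathbb B}d\pi^{\mathbb A}$, and $\hat c=\hat c^\oplus+\hat c^\ominus$, well-defined when $\hat c^\oplus<+\infty$ or $\hat c^\ominus>-\infty$. A point as an argument of $\hat c$ stands for the measure concentrated at that point. $\mathbb{P}^S(\mathbb{A})$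 (resp. $\mathbb{P}^S(\mathbb{B})$) is the set of strategies $\pi^{\mathbb A}$ (resp. $\pi^{\mathbb B}$) such that $\hat c(\pi^{\mathbb A},\pi^{\mathbb B})$ is well-defined for all strategies of the other player. $\hat c^{\sharp}(\pi^{\mathbb A})=\sup_{b\in\mathbb{B}}\hat c(\pi^{\mathbb A},b)$, $\hat c^{\flat}(\pi^{\mathbb B})=\inf_{a\in\mathbb{A}}\hat c(a,\pi^{\mathbb B})$, $\mathbb{P}^\sharp_\alpha(\mathbb{A})=\{\pi^{\mathbb A}\in\mathbb{P}(\mathbb{A}):\hat c^\sharp(\pi^{\mathbb A})\le\alpha\}$, $\mathbb{P}^\flat_\beta(\mathbb{B})=\{\pi^{\mathbb B}\in\mathbb{P}(\mathbb{B}):\hat c^\flat(\pi^{\mathbb B})\ge\beta\}$. The lopsided value of the game is the number $v=\sup_{\pi^{\mathbb B}\in\mathbb{P}^S(\mathbb{B})}\hat c^\flat(\pi^{\mathbb B})=\inf_{\pi^{\mathbb A}\in\mathbb{P}(\mathbb{A})}\hat c^\sharp(\pi^{\mathbb A})$, if this equality holds. A solution of the game is a pair $(\pi^{\mathbb A},\pi^{\mathbb B})\in\mathbb{P}^S(\mathbb{A})\times\mathbb{P}^S(\mathbb{B})$ such that $\hat c(\pi^{\mathbb A},\pi^{\mathbb B}_* )\le\hat c(\pi^{\mathbb A},\pi^{\mathbb B})\le\hat c(\pi^{\mathbb A}_*,\pi^{\mathbb B})$ for all $\pi^{\mathbb A}_*\in\mathbb{P}(\mathbb{A})$ and $\pi^{\mathbb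 B}_*\in\mathbb{P}(\mathbb{B})$. *)

(* Defs.v *)
From HB Require Import structures.
From mathcomp Require Import all_boot all_order all_algebra.
From mathcomp Require Import interval_inference.
From mathcomp Require Import all_classical all_reals all_analysis.

Set Implicit Arguments.
Unset Strict Implicit.
Unset Printing Implicit Defensive.

Import Order.TTheory GRing.Theory Num.Theory.
Import numFieldNormedType.Exports.

Local Open Scope classical_set_scope.
Local Open Scope ring_scope.

(* A Polish space is presented with one of its complete separable metrics;
   everything below depends on that metric only through its topology. *)
Definition polish (R : realType) (X : metricType R) : Prop :=
  (forall F : set_system X, ProperFilter F -> cauchy F -> exists x : X, F --> x) /\
  (exists2 D : set X, countable D & dense D).

(* The subset [A] as a space of its own, with the subspace topology.  The
   nonemptiness proof is an argument of the type because the measurable types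
   of the library are pointed. *)
Definition subspace_type (X : topologicalType) (A : set X)
  (A0 : A !=set0) : Type := set_type A.

HB.instance Definition _ (X : topologicalType) (A : set X) (A0 : A !=set0) :=
  Topological.copy (subspace_type A0) (set_type A).
HB.instance Definition _ (X : topologicalType) (A : set X) (A0 : A !=set0) :=
  isPointed.Build (subspace_type A0)
    (exist _ (projT1 (cid A0)) (mem_set (projT2 (cid A0)))).

HB.instance Definition _ (E F : ptopologicalType) := Pointed.on (E * F)%type.

Definition borel (E : ptopologicalType) : measurableType (@open E).-sigma :=
  g_sigma_algebraType (@open E).

Section strategies.
Variables (R : realType) (E : ptopologicalType).

(* Two elements that agree on all Borel sets represent the same measure:
   the library's measures also carry irrelevant values on the other sets. *)
Definition strategy : Type := probability (borel E) R.
HB.instance Definition _ := Choice.on strategy.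

Definition bounded_continuous : Type :=
  {f : E -> R | continuous f /\ bounded_fun f}.
HB.instance Definition _ := gen_eqMixin bounded_continuous.
HB.instance Definition _ := gen_choiceMixin bounded_continuous.

Definition integrals (mu : strategy) : {ptws bounded_continuous -> R} :=
  fun f => Rintegral mu setT (sval f).

(* The topology of weak convergence: the coarsest one for which
   [mu |-> \int f dmu] is continuous for every bounded continuous [f]. *)
HB.instance Definition _ :=
  Topological.copy strategy (initial_topology integrals).

Section mixture.
Variables (t : {i01 R}) (mu nu : strategy).

Definition mixture : set (borel E) -> \bar R :=
  measure_add (mscale (t%:num)%:nng mu) (mscale (1 - t%:num)%:nng nu).

HB.instance Definition _ := Measure.on mixture.

Let mixture_setT : mixture setT = 1%E.
Proof.
have -> : mixture setT =
    (t%:num%:E * mu setT + (1 - t%:num)%:E * nu setT)%E.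
  by rewrite /mixture measure_addE.
by rewrite (probability_setT mu) (probability_setT nu) !mule1 -EFinD addrC subrK.
Qed.

HB.instance Definition _ := Measure_isProbability.Build _ _ _ mixture
  mixture_setT.

End mixture.

Definition convex_strategies (S : set strategy) : Prop :=
  forall (t : {i01 R}) (mu nu : strategy),
    S mu -> S nu -> S (mixture t mu nu : probability _ _).

End strategies.

Definition K_inf_compact (R : realType) (U V : topologicalType)
    (g : U * V -> \bar R) : Prop :=
  forall (C : set U) (lambda : R), C !=set0 -> compact C ->
    compact [set z : U * V | C z.1 /\ (g z <= lambda%:E)%E].

Definition K_sup_compact (R : realType) (U V : topologicalType)
    (g : U * V -> \bar R) : Prop :=
  K_inf_compact (fun z => - g z)%E.

Definition is_game (R : realType) (X Y : metricType R) (A : set X) (B : set Y)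
    (A0 : A !=set0) (B0 : B !=set0)
    (c : subspace_type A0 * subspace_type B0 -> R) : Prop :=
  [/\ polish X /\ <<s @open X >> A,
      polish Y /\ <<s @open Y >> B,
      measurable_fun setT
        (c : borel (subspace_type A0 * subspace_type B0)%type -> R),
      forall b, has_lbound (range (fun a => c (a, b))) &
      forall a, has_ubound (range (fun b => c (a, b)))].

Section game.
Variables (R : realType) (A B : ptopologicalType) (c : A * B -> R).
Local Open Scope ereal_scope.

Definition chat_plus (muA : strategy R A) (muB : strategy R B) : \bar R :=
  \int[muA]_a \int[muB]_b (Num.max (c (a, b)) 0)%:E.

Definition chat_minus (muA : strategy R A) (muB : strategy R B) : \bar R :=
  \int[muA]_a \int[muB]_b (Num.min (c (a, b)) 0)%:E.

Definition chat_defined (muA : strategy R A) (muB : strategy R B) : Prop :=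
  chat_plus muA muB < +oo \/ -oo < chat_minus muA muB.

(* Meaningful only under [chat_defined], since [+oo - oo] is [-oo] here. *)
Definition chat (muA : strategy R A) (muB : strategy R B) : \bar R :=
  chat_plus muA muB + chat_minus muA muB.

Definition PS_A : set (strategy R A) :=
  [set muA | forall muB, chat_defined muA muB].

Definition PS_B : set (strategy R B) :=
  [set muB | forall muA, chat_defined muA muB].

Definition point_mass (E : ptopologicalType) (x : E) : strategy R E :=
  dirac (x : borel E).

Definition chat_sharp (muA : strategy R A) : \bar R :=
  ereal_sup [set chat muA (point_mass b) | b in [set: B]].

Definition chat_flat (muB : strategy R B) : \bar R :=
  ereal_inf [set chat (point_mass a) muB | a in [set: A]].

Definition P_sharp (alpha : R) : set (strategy R A) :=
  [set muA | chat_sharp muA <= alpha%:E].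

Definition P_flat (beta : R) : set (strategy R B) :=
  [set muB | beta%:E <= chat_flat muB].

Definition lopsided_value (v : R) : Prop :=
  v%:E = ereal_sup [set chat_flat muB | muB in PS_B] /\
  v%:E = ereal_inf [set chat_sharp muA | muA in [set: strategy R A]].

Definition solution (muA : strategy R A) (muB : strategy R B) : Prop :=
  [/\ PS_A muA, PS_B muB &
      forall (muA' : strategy R A) (muB' : strategy R B),
        chat muA muB' <= chat muA muB <= chat muA' muB].

End game.

(* Main.v *)
(* By (b) and (c) the space B is compact; by (a) the payoff is lower
   semicontinuous, and all sets {a | c (a, b) <= r} are compact; c is continuous
   in each variable.  Weak compactness of sets of strategies comes from a Riesz
   representation theorem: positive normalized functionals on bounded continuous
   functions form a compact set (Tychonoff), and such a functional is an
   integral as soon as it almost lives on compact sets.  On B this is automatic;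
   on A it follows from a bound on the integrals of the truncations of c (., b).
   With v the infimum of the guarantees of the minimizer, Blackwell's
   approachability gives, for finitely many a, an empirical distribution on B
   with payoff at least v - e against each of them, and compactness of B turns
   this into one optimal strategy.  Tonelli's theorem then makes every pair of
   optimal strategies a saddle point and conversely. *)
Require Import Defs.
From HB Require Import structures.
From mathcomp Require Import all_boot all_order all_algebra.
From mathcomp Require Import finmap ring lra.
From mathcomp Require Import interval_inference.
From mathcomp Require Import all_classical all_reals all_analysis.
From mathcomp Require Import measurable_realfun.

Set Implicit Arguments.
Unset Strict Implicit.
Unset Printing Implicit Defensive.

Import Order.TTheory GRing.Theory Num.Theory.
Import numFieldNormedType.Exports.

Local Open Scope classical_set_scope.
Local Open Scope ring_scope.

(** * Bounded continuous functions and positive functionals *)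

(** The payoff may be unbounded above in [a], so its integral need not be weakly continuous on the
    minimizer's side. The truncations [min (c (a, b)) (m + n)] repair this: they are bounded
    continuous in [a], and by monotone convergence the guarantees of a strategy are inequalities on
    their integrals alone. On the side of B, compactness already makes every [c (a, .)] bounded.
    Limits are taken among functionals, where compactness costs nothing; tightness is checked only
    for the limit, which is then turned back into a measure. Blackwell's argument needs a reply to
    each finite weighting of points [a]: a normalized weighting is itself a strategy of the
    minimizer, and if no [b] earned [v - e] against it, it would guarantee a level below the infimum
    [v]. *)

Section bounded_continuous_functions.
Variables (R : realType) (E : topologicalType).
Implicit Types f g : E -> R.

Definition bcont f : Prop := continuous f /\ bounded_fun f.

Lemma bcontP f :
  bcont f <-> continuous f /\ exists M : R, forall x, `|f x| <= M.
Proof.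
split=> -[cf]; first move=> [M [_ fM]]; last move=> [M fM]; split=> //.
  by exists (M + 1) => x; apply: fM => //; rewrite ltrDl.
exists M; split; first by rewrite num_real.
by move=> N /ltW MN x _; exact: le_trans (fM x) MN.
Qed.

Lemma continuous_add f g : continuous f -> continuous g ->
  continuous (fun x => f x + g x).
Proof. by move=> cf cg x; apply: cvgD; [exact: cf|exact: cg]. Qed.

Lemma continuous_mul f g : continuous f -> continuous g ->
  continuous (fun x => f x * g x).
Proof. by move=> cf cg x; apply: cvgM; [exact: cf|exact: cg]. Qed.

Lemma continuous_opp f : continuous f -> continuous (fun x => - f x).
Proof. by move=> cf x; apply: cvgN; exact: cf. Qed.

Lemma bcont_cst (r : R) : bcont (fun=> r).
Proof. by apply/bcontP; split; [exact: cst_continuous|exists `|r|]. Qed.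

Lemma bcontD f g : bcont f -> bcont g -> bcont (fun x => f x + g x).
Proof.
move=> /bcontP[cf [M fM]] /bcontP[cg [N gN]]; apply/bcontP; split.
  exact: continuous_add.
by exists (M + N) => x; rewrite (le_trans (ler_normD _ _))// lerD.
Qed.

Lemma bcontM f g : bcont f -> bcont g -> bcont (fun x => f x * g x).
Proof.
move=> /bcontP[cf [M fM]] /bcontP[cg [N gN]]; apply/bcontP; split.
  exact: continuous_mul.
by exists (M * N) => x; rewrite normrM ler_pM.
Qed.

Lemma bcontZ r f : bcont f -> bcont (fun x => r * f x).
Proof. by move=> ?; apply: bcontM => //; exact: bcont_cst. Qed.

Lemma bcontN f : bcont f -> bcont (fun x => - f x).
Proof.
by move=> /(bcontZ (-1)); congr bcont; apply/funext => x; rewrite mulN1r.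
Qed.

Lemma bcontB f g : bcont f -> bcont g -> bcont (fun x => f x - g x).
Proof. by move=> bf bg; apply: bcontD => //; exact: bcontN. Qed.

Lemma continuous_max f g : continuous f -> continuous g ->
  continuous (fun x => Num.max (f x) (g x)).
Proof.
move=> cf cg; under eq_fun do rewrite maxr_absE.
move=> x; apply: cvgM; last exact: cvg_cst.
apply: cvgD; first by apply: cvgD; [exact: cf|exact: cg].
by apply: cvg_norm; apply: cvgB; [exact: cf|exact: cg].
Qed.

Lemma bcont_max f g : bcont f -> bcont g ->
  bcont (fun x => Num.max (f x) (g x)).
Proof.
move=> /bcontP[cf [M fM]] /bcontP[cg [N gN]]; apply/bcontP; split.
  exact: continuous_max.
exists (M + N) => x; have := fM x; have := gN x.
have := normr_ge0 (f x); have := normr_ge0 (g x).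
by case: (leP (f x) (g x)) => _; lra.
Qed.

Lemma continuous_min f g : continuous f -> continuous g ->
  continuous (fun x => Num.min (f x) (g x)).
Proof.
move=> cf cg; rewrite (_ : (fun x => _) = (fun x => - Num.max (- f x) (- g x))).
  by move=> x; apply: cvgN; apply: continuous_max => y; apply: cvgN;
    [exact: cf|exact: cg].
by apply/funext => x; rewrite oppr_max !opprK.
Qed.

Lemma bcont_min f g : bcont f -> bcont g ->
  bcont (fun x => Num.min (f x) (g x)).
Proof.
move=> bf bg; rewrite (_ : (fun x => _) = (fun x => - Num.max (- f x) (- g x))).
  by apply/bcontN/bcont_max; exact: bcontN.
by apply/funext => x; rewrite oppr_max !opprK.
Qed.

Lemma bcont_sum (f : nat -> E -> R) n : (forall i, bcont (f i)) ->
  bcont (fun x => \sum_(i < n) f i x).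
Proof.
move=> bf; elim: n => [|n ih].
  by under eq_fun do rewrite big_ord0; exact: bcont_cst.
by under eq_fun do rewrite big_ord_recr; exact: bcontD.
Qed.

End bounded_continuous_functions.

Section positive_functional.
Variables (R : realType) (E : topologicalType).
Implicit Types (f g : E -> R) (L : (E -> R) -> R).

Definition pfunctional L : Prop :=
  [/\ forall f g, bcont f -> bcont g -> L (fun x => f x + g x) = L f + L g,
      forall r f, bcont f -> L (fun x => r * f x) = r * L f,
      forall f, bcont f -> (forall x, 0 <= f x) -> 0 <= L f &
      L (fun=> 1) = 1].

(** [L] need not make sense on indicators, so the mass of [K] is tested by the continuous functions
    that dominate its indicator. *)
Definition tight_functional L : Prop :=
  forall e : R, 0 < e -> exists K : set E, compact K /\
    forall f, bcont f -> (forall x, 0 <= f x) -> (forall x, K x -> 1 <= f x) ->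
      1 - e <= L f.

Variable L : (E -> R) -> R.
Hypothesis pL : pfunctional L.

Lemma pfunctionalD f g : bcont f -> bcont g ->
  L (fun x => f x + g x) = L f + L g.
Proof. by case: pL => + _ _ _; exact. Qed.

Lemma pfunctionalZ r f : bcont f -> L (fun x => r * f x) = r * L f.
Proof. by case: pL => _ + _ _; exact. Qed.

Lemma pfunctional_ge0 f : bcont f -> (forall x, 0 <= f x) -> 0 <= L f.
Proof. by case: pL => _ _ + _; exact. Qed.

Lemma pfunctional_cst r : L (fun=> r) = r.
Proof.
case: pL => _ _ _ L1; rewrite -[RHS]mulr1 -L1 -pfunctionalZ.
  by under [in RHS]eq_fun do rewrite mulr1.
exact: bcont_cst.
Qed.

Lemma pfunctionalN f : bcont f -> L (fun x => - f x) = - L f.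
Proof.
by move=> bf; rewrite -mulN1r -pfunctionalZ//;
  under [in RHS]eq_fun do rewrite mulN1r.
Qed.

Lemma pfunctionalB f g : bcont f -> bcont g ->
  L (fun x => f x - g x) = L f - L g.
Proof. by move=> bf bg; rewrite pfunctionalD ?pfunctionalN//;
  exact: bcontN. Qed.

Lemma pfunctional_le f g : bcont f -> bcont g -> (forall x, f x <= g x) ->
  L f <= L g.
Proof.
move=> bf bg fg; rewrite -subr_ge0 -pfunctionalB//.
by apply: pfunctional_ge0; [exact: bcontB|move=> x; rewrite subr_ge0].
Qed.

Lemma pfunctional_sum (f : nat -> E -> R) n : (forall i, bcont (f i)) ->
  L (fun x => \sum_(i < n) f i x) = \sum_(i < n) L (f i).
Proof.
move=> bf; elim: n => [|n ih].
  by under eq_fun do rewrite big_ord0; rewrite big_ord0 pfunctional_cst.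
under eq_fun do rewrite big_ord_recr.
by rewrite pfunctionalD ?ih ?big_ord_recr//; exact: bcont_sum.
Qed.

End positive_functional.

(** * Riesz representation *)

Section daniell_outer_measure.
Variables (R : realType) (E : ptopologicalType).
Variable L : (E -> R) -> R.
Hypothesis pL : pfunctional L.
Implicit Types (S G : set E) (f : E -> R).

(* Coverings are increasing sequences of functions, so that a countable union
   is covered by a diagonal sequence. *)
Definition daniell_cost S : set R := [set r | exists g : nat -> E -> R,
  [/\ forall n, bcont (g n), forall n x, 0 <= g n x,
      forall x m n, (m <= n)%N -> g m x <= g n x,
      forall x, S x -> exists n, 1 <= g n x &
      forall n, L (g n) <= r]].

Definition daniell S : R := inf (daniell_cost S).

Lemma daniell_cost_ge0 S r : daniell_cost S r -> 0 <= r.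
Proof.
by move=> [g [bg g0 _ _ gr]]; apply: le_trans (gr 0%N); exact: pfunctional_ge0.
Qed.

Lemma daniell_cost1 S : daniell_cost S 1.
Proof.
exists (fun=> fun=> 1); split => //.
- by move=> n; exact: bcont_cst.
- by move=> x _; exists 0%N.
- by move=> n; rewrite pfunctional_cst.
Qed.

Lemma daniell_le S r : daniell_cost S r -> daniell S <= r.
Proof.
by move=> Sr; apply: ge_inf => //; exists 0 => s; exact: daniell_cost_ge0.
Qed.

Lemma le_daniell S r : (forall s, daniell_cost S s -> r <= s) -> r <= daniell S.
Proof. by move=> h; apply: lb_le_inf => //; exists 1; exact: daniell_cost1. Qed.

Lemma daniell_adherent S e : 0 < e ->
  exists2 r, daniell_cost S r & r < daniell S + e.
Proof.
move=> e0; apply: inf_adherent => //; split; first by exists 1;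
  exact: daniell_cost1.
by exists 0 => s; exact: daniell_cost_ge0.
Qed.

Lemma daniell_ge0 S : 0 <= daniell S.
Proof. by apply: le_daniell => r; exact: daniell_cost_ge0. Qed.

Lemma daniell_le_fun S f : bcont f -> (forall x, 0 <= f x) ->
  (forall x, S x -> 1 <= f x) -> daniell S <= L f.
Proof.
move=> bf f0 Sf; apply: daniell_le; exists (fun=> f); split => //.
by move=> x /Sf; exists 0%N.
Qed.

Lemma daniell_set0 : daniell set0 = 0.
Proof.
apply/eqP; rewrite eq_le daniell_ge0 andbT -(pfunctional_cst pL 0).
by apply: daniell_le_fun => //; exact: bcont_cst.
Qed.

Lemma daniell_mono S T : S `<=` T -> daniell S <= daniell T.
Proof.
move=> ST; apply: le_daniell => r [g [bg g0 gh gT gr]]; apply: daniell_le.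
by exists g; split => // x /ST /gT.
Qed.

(* The diagonal sequence is [n |-> \sum_(i <= n) g i n]. *)
Lemma daniell_bigcup (F : nat -> set E) s :
  (forall n, \sum_(i < n) daniell (F i) <= s) -> daniell (\bigcup_n F n) <= s.
Proof.
move=> Fs; apply/ler_addgt0Pr => e e0.
have pick i : {g : nat -> E -> R |
    [/\ forall n, bcont (g n), forall n x, 0 <= g n x,
      forall x m n, (m <= n)%N -> g m x <= g n x,
      forall x, F i x -> exists n, 1 <= g n x &
      forall n, L (g n) <= daniell (F i) + e / (2 ^ i.+1)%:R]}.
  apply: cid; have [|r [g [bg g0 gh gS gr]] re] := @daniell_adherent (F i) (e /
    (2 ^ i.+1)%:R).
    by rewrite divr_gt0// ltr0n expn_gt0.
  by exists g; split => // n; exact: le_trans (gr n) (ltW re).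
pose g i := sval (pick i).
have gP i := svalP (pick i).
have bg i n : bcont (g i n) by case: (gP i) => + _ _ _ _; exact.
have g0 i n x : 0 <= g i n x by case: (gP i) => _ + _ _ _; exact.
apply: daniell_le; exists (fun n x => \sum_(i < n.+1) g i n x); split.
- by move=> n; apply: (bcont_sum n.+1 (fun i => bg i n)).
- by move=> n x; apply: sumr_ge0.
- move=> x m n mn; apply: (@le_trans _ _ (\sum_(i < m.+1) g i n x)).
    by apply: ler_sum => i _; case: (gP i) => _ _ gh _ _; exact: gh.
  rewrite -!(big_mkord xpredT (fun i =>
    g i n x)) [leRHS](big_cat_nat _ (n := m.+1))//=.
  by rewrite lerDl sumr_ge0.
- move=> x [i _ Fix]; case: (gP i) => _ _ gh /(_ _ Fix)[n gn] _.
  exists (maxn i n); have im : (i < (maxn i n).+1)%N by rewrite ltnS leq_maxl.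
  rewrite (bigD1 (Ordinal im))//= (le_trans gn)// (@le_trans _ _ (g i (maxn i
    n) x))//.
    by apply: gh; exact: leq_maxr.
  by rewrite lerDl sumr_ge0.
- move=> n; rewrite (pfunctional_sum pL n.+1 (fun i => bg i n)).
  apply: (@le_trans _ _ (\sum_(i < n.+1) (daniell (F i) + e / (2 ^ i.+1)%:R))).
    by apply: ler_sum => i _; case: (gP i) => _ _ _ _ gr; exact: gr.
  rewrite big_split/=; apply: lerD; first exact: Fs.
  have -> : \sum_(i < n.+1) e / (2 ^ i.+1)%:R = e - e / (2 ^ n.+1)%:R :> R.
    elim: n => [|n ih]; first by rewrite big_ord_recr big_ord0/= add0r; lra.
    rewrite big_ord_recr/= ih (expnS 2 n.+1) natrM.
    have : (2 ^ n.+1)%:R != 0 :> R by rewrite pnatr_eq0 expn_eq0.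
    by set q := (2 ^ n.+1)%:R => q0; field; rewrite q0.
  by rewrite lerBlDr lerDl divr_ge0 ?ler0n// ltW.
Qed.

(* With [phi k] increasing to the indicator of [G], the part of [S] in [G] is
   covered by [g n * phi n] and the rest by [g n * (1 - phi k)], [k] large. *)
Lemma daniell_split S G : (exists g : E -> R,
    [/\ continuous g, forall x, 0 <= g x & forall x, G x <-> 0 < g x]) ->
  daniell (S `&` G) + daniell (S `&` ~` G) <= daniell S.
Proof.
move=> [h [ch h0 hG]]; apply: le_daniell => r [g [bg g0 gh gS gr]].
pose phi (k : nat) x := Num.min (k%:R * h x) 1.
have kh_ge0 (k : nat) x : 0 <= k%:R * h x by rewrite mulr_ge0.
have phi0 k x : 0 <= phi k x by rewrite /phi le_min kh_ge0 ler01.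
have phi1 k x : phi k x <= 1 by rewrite /phi ge_min lexx orbT.
have bphi k : bcont (phi k).
  apply/bcontP; split; last by exists 1 => x; rewrite ger0_norm.
  rewrite /phi; apply: continuous_min; last exact: cst_continuous.
  by move=> x; apply: cvgM; [exact: cvg_cst|exact: ch].
have phih x m n : (m <= n)%N -> phi m x <= phi n x.
  move=> mn; rewrite /phi le_min ge_min ler_wpM2r ?ler_nat//=.
  by rewrite ge_min lexx orbT.
have bgp n k : bcont (fun x => g n x * phi k x) by exact: bcontM.
(* [l] is the limit of a nondecreasing sequence. Once the term of index [k] is within [e] of it, [L]
   is at most [r - l + e] on [g n * (1 - phi k)] for every [n]. *)
pose l := sup (range (fun n => L (fun x => g n x * phi n x))).
have lub : has_ubound (range (fun n => L (fun x => g n x * phi n x))).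
  exists r => _ [n _ <-]; apply: le_trans (gr n).
  by apply: pfunctional_le => // x; rewrite ler_piMr.
have gpl n : L (fun x => g n x * phi n x) <= l.
  by apply: ub_le_sup => //; exists n.
have SG : daniell (S `&` G) <= l.
  apply: daniell_le; exists (fun n x => g n x * phi n x); split => //.
  - by move=> n x; rewrite mulr_ge0.
  - by move=> x m n mn; rewrite ler_pM ?gh ?phih.
  - move=> x [/gS[n gn] /hG hx].
    have [k hk] : exists k : nat, 1 <= k%:R * h x.
      exists (Num.truncn (h x)^-1).+1.
      by rewrite -ler_pdivrMr// div1r ltW// truncnS_gt.
    exists (maxn n k); rewrite -[leLHS]mulr1 ler_pM//.
      by rewrite (le_trans gn)// gh// leq_maxl.
    apply: (@le_trans _ _ (phi k x)); last by apply: phih; exact: leq_maxr.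
    by rewrite /phi le_min hk lexx.
apply/ler_addgt0Pr => e e0.
have [_ [k _ <-] lk] : exists2 t, range (fun n => L (fun x =>
  g n x * phi n x)) t & l - e < t.
  by apply: sup_adherent => //; split => //;
    exists (L (fun x => g 0%N x * phi 0%N x)); exists 0%N.
suff : daniell (S `&` ~` G) <= r - l + e by move: SG; lra.
have bgc n : bcont (fun x => g n x * (1 - phi k x)).
  by apply: bcontM => //; apply: bcontB => //; exact: bcont_cst.
have step n : (k <= n)%N -> L (fun x => g n x * (1 - phi k x)) <= r - l + e.
  move=> kn.
  have -> : L (fun x => g n x * (1 - phi k x)) = L (g n) - L (fun x =>
    g n x * phi k x).
    by rewrite -pfunctionalB//; congr L; apply/funext => x;
      rewrite mulrBr mulr1.
  have : L (fun x => g k x * phi k x) <= L (fun x => g n x * phi k x).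
    by apply: pfunctional_le => // x; rewrite ler_wpM2r// gh.
  by move: (gr n) lk; lra.
apply: daniell_le; exists (fun n x => g n x * (1 - phi k x)); split => //.
- by move=> n x; rewrite mulr_ge0// subr_ge0.
- by move=> x m n mn; rewrite ler_wpM2r ?gh// subr_ge0.
- move=> x [/gS[n gn] nGx]; exists n;
    suff -> : phi k x = 0 by rewrite subr0 mulr1.
  have -> : phi k x = Num.min (k%:R * h x) 1 by [].
  have : ~ 0 < h x by move=> /hG.
  move=> /negP; rewrite -leNgt => hx0.
  have -> : h x = 0 by apply/eqP; rewrite eq_le hx0 h0.
  by rewrite mulr0 min_l.
- move=> n; have [/step//|nk] := leqP k n.
  apply: le_trans (step k (leqnn k)); apply: pfunctional_le => // x.
  by rewrite ler_wpM2r ?subr_ge0// gh// ltnW.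
Qed.

(* Dini's theorem on a compact set carrying almost all of [L]. *)
Lemma daniell_setT : tight_functional L -> daniell setT = 1.
Proof.
move=> tL; apply/eqP; rewrite eq_le daniell_le ?andTb;
  last exact: daniell_cost1.
apply: le_daniell => r [g [bg g0 gh gT gr]].
apply/ler_addgt0Pr => e e0.
have [K [cK LK]] := tL (e / 2) ltac:(by rewrite divr_gt0).
(* The factor [d > 1] turns [1 <= g n x] into a strict inequality, so that compactness of [K]
   applies to open sets. *)
pose d := 1 + e / 2.
have d0 : 0 < d by rewrite /d; lra.
have [n gn] : exists n, forall x, K x -> 1 <= d * g n x.
  move: cK; rewrite compact_cover => /(_ nat setT (fun n =>
    [set x | 1 < d * g n x])).
  case.
  - move=> n _; rewrite (_ : [set x | _] = (fun x =>
      d * g n x) @^-1` `]1, +oo[%classic); last first.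
      by apply/seteqP; split => x /=; rewrite in_itv/= andbT.
    have /bcontP[/continuousP + _] := bcontZ d (bg n); apply;
      exact: interval_open.
  - move=> x _; have [n gn] := gT x I; exists n => //=.
    by rewrite (lt_le_trans _ (ler_wpM2l (ltW d0) gn))// mulr1 /d; lra.
  - move=> D _ KD; exists (\max_(i <- enum_fset D) i)%N =>
      x /KD[i /= iD /ltW] /le_trans; apply.
    rewrite ler_wpM2l ?(ltW d0)// gh//.
    by rewrite (@leq_bigmax_seq _ (enum_fset D) xpredT (fun i => i) i)//.
have := LK _ (bcontZ d (bg n)) (fun x => mulr_ge0 (ltW d0) (g0 n x)) gn.
rewrite pfunctionalZ// => h.
(* If [r <= 1], the factor [d] adds at most [e / 2] to [r]; if [1 < r], the goal is immediate. *)
have r1 : r <= 1 \/ 1 < r by case: (leP r 1); [left|right].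
have : d * L (g n) <= d * r by rewrite ler_pM2l.
by rewrite /d in h *; case: r1; nra.
Qed.

End daniell_outer_measure.

Section strategy_integral.
Variables (R : realType) (E : ptopologicalType).
Implicit Types (mu : strategy R E) (f : E -> R).

Lemma semicontinuous_measurable f :
  (forall r, open [set x | r < f x]) -> measurable_fun setT (f : borel E -> R).
Proof.
move=> of_; apply: (measurability _ (RGenOInfty.measurableE R)).
move=> _ [_ [r ->] <-]; rewrite setTI; apply: sub_sigma_algebra.
rewrite (_ : _ @^-1` _ = [set x | r < f x]); first exact: of_.
by apply/seteqP; split => x /=; rewrite in_itv/= andbT.
Qed.

Lemma continuous_measurable f :
  continuous f -> measurable_fun setT (f : borel E -> R).
Proof.
move=> /continuousP cf; apply: semicontinuous_measurable => r.
rewrite (_ : [set x | _] = f @^-1` `]r, +oo[%classic).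
  by apply: cf; exact: interval_open.
by apply/seteqP; split => x /=; rewrite in_itv/= andbT.
Qed.

Lemma bcont_integrable mu f : bcont f -> mu.-integrable setT (EFin \o (f :
  borel E -> R)).
Proof.
move=> [cf bf]; apply: measurable_bounded_integrable => //.
  by rewrite [X in (X < _)%E](probability_setT mu) ltry.
exact: continuous_measurable.
Qed.

Lemma pfunctional_Rintegral mu : pfunctional (fun f => Rintegral mu setT f).
Proof.
split.
- by move=> f g bf bg; rewrite RintegralD//; exact: bcont_integrable.
- by move=> r f bf; rewrite RintegralZl//; exact: bcont_integrable.
- by move=> f _ f0; exact: Rintegral_ge0.
- by rewrite Rintegral_cst// [X in fine X](probability_setT mu) mulr1.
Qed.

End strategy_integral.

Section riesz.
Variables (R : realType) (E : ptopologicalType).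

(** In a metric space the distance to the complement is such a [g]. The representation theorem sees
    the space only through this property, which makes open sets Caratheodory measurable. *)
Definition cozero_opens : Prop := forall G : set E, open G ->
  exists g : E -> R, [/\ continuous g, forall x, 0 <= g x &
                         forall x, G x <-> 0 < g x].

Hypothesis cozeroE : cozero_opens.
Variable L : (E -> R) -> R.
Hypotheses (pL : pfunctional L) (tL : tight_functional L).

(** By [daniell_split] open sets are Caratheodory measurable, hence so are Borel sets. The equality
    holds for all [S] because the strategy has the outer measure itself as underlying function. *)
Lemma daniell_strategy :
  exists mu : strategy R E, forall S, mu S = (daniell L S)%:E.
Proof.
pose gam (S : set E) : \bar R := (daniell L S)%:E.
have g0 : gam set0 = 0%E by rewrite /gam daniell_set0.
have gge0 S : (0 <= gam S)%E by rewrite lee_fin daniell_ge0.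
have gle : {homo gam : A B / A `<=` B >-> (A <= B)%E}.
  by move=> A B AB; rewrite lee_fin daniell_mono.
have gss : sigma_subadditive gam.
  move=> F; rewrite /gam; set s := (\sum_(_ <oo) _)%E.
  have Fs n : ((\sum_(i < n) daniell L (F i))%:E <= s)%E.
    rewrite -sumEFin -(big_mkord xpredT (fun i => (daniell L (F i))%:E)).
    by apply: nneseries_lim_ge => i _ _; exact: gge0.
  case: s Fs => [s Fs|_|/(_ 0%N)]; last by rewrite big_ord0.
  - by rewrite lee_fin; apply: daniell_bigcup => // n; rewrite -lee_fin.
  - by rewrite leey.
pose mu0 : {outer_measure set E -> \bar R} :=
  HB.pack gam (isOuterMeasure.Build R E gam g0 gge0 gle gss).
have sub (A : set (borel E)) : measurable A -> mu0.-caratheodory A.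
  apply: (@smallest_sub _ _ (@open E) (measurable : set (set (caratheodory_type
    mu0)))).
    exact: (@sigma_algebra_measurable _ (caratheodory_type mu0)).
  move=> G oG; apply: le_caratheodory_measurable => S.
  by rewrite -EFinD lee_fin daniell_split//; exact: cozeroE.
have sadd : semi_sigma_additive (gam : set (borel E) -> \bar R).
  move=> F mF tF mUF.
  apply: (@measure_semi_sigma_additive _ _ _
    (mu0 : {measure set (caratheodory_type mu0) -> \bar R}) F) => //.
    by move=> i; exact: sub.
  exact: sub.
have gT : gam setT = 1%E by rewrite /gam daniell_setT.
pose nu0 : {measure set (borel E) -> \bar R} :=
  HB.pack gam (@isMeasure.Build _ (borel E) R gam g0 gge0 sadd).
pose nu : strategy R E := HB.pack (Measure.sort nu0)
  (@Measure_isProbability.Build _ (borel E) R nu0 gT).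
by exists nu.
Qed.

(* Cutting [f] into slices of height [d] gives
   [\int f dmu <= L f + d * mu {f > 0}] for [f >= 0]; applied to [- f] as well,
   this yields equality. *)
Theorem riesz_representation :
  exists mu : strategy R E, forall f, bcont f -> Rintegral mu setT f = L f.
Proof.
have [mu muE] := daniell_strategy; exists mu.
pose I (f : E -> R) := Rintegral mu setT f.
have pI : pfunctional I by exact: pfunctional_Rintegral.
have ind (G : set E) : open G -> Rintegral mu setT (\1_G : borel E -> R) =
  daniell L G.
  move=> oG; rewrite /Rintegral integral_indic//; last exact: sub_sigma_algebra.
  by rewrite setIT [X in fine X](muE G).
have posop (f : E -> R) : bcont f -> open [set x | 0 < f x].
  move=> [/continuousP cf _];
    rewrite (_ : [set x | _] = f @^-1` `]0, +oo[%classic).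
    by apply: cf; exact: interval_open.
  by apply/seteqP; split => x /=; rewrite in_itv/= andbT.
have key d : 0 < d -> forall n f, bcont f -> (forall x, 0 <= f x <= n%:R * d) ->
    I f <= L f + d * daniell L [set x | 0 < f x].
  move=> d0; elim => [|n ih] f bf f0.
    have -> : f = (fun=> 0).
      by apply/funext => x; have := f0 x; rewrite mul0r -eq_le => /eqP.
    by rewrite !pfunctional_cst// add0r mulr_ge0 ?daniell_ge0// ltW.
  have bmin : bcont (fun x => Num.min (f x) d).
    by apply: bcont_min => //; exact: bcont_cst.
  have bmax : bcont (fun x => Num.max (f x - d) 0).
    by apply: bcont_max; [apply: bcontB => //|]; exact: bcont_cst.
  (* The bottom slice and the rest. The error of the rest in [h1] is absorbed by [L] of the bottom
     slice in [h2], so errors do not accumulate with [n]; only the one from [h3] remains. *)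
  have fE : f = fun x => Num.min (f x) d + Num.max (f x - d) 0.
    by apply/funext => x; case: (leP (f x) d) => fd; case: (leP (f x - d) 0);
      lra.
  rewrite [in I f]fE [in L f]fE !pfunctionalD//.
  have h1 : I (fun x => Num.max (f x - d) 0) <=
      L (fun x => Num.max (f x - d) 0) + d * daniell L [set x | 0 < Num.max (f
        x - d) 0].
    apply: ih => // x; have := f0 x; rewrite le_max lexx orbT/= ge_max.
    rewrite (mulr_ge0 _ (ltW d0))//= andbT -[n.+1]addn1 natrD mulrDl mul1r.
    by move=> /andP[_]; lra.
  have h2 : d * daniell L [set x | 0 < Num.max (f x - d) 0] <= L (fun x =>
    Num.min (f x) d).
    have -> : L (fun x => Num.min (f x) d) = d * L (fun x =>
      d^-1 * Num.min (f x) d).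
      by rewrite pfunctionalZ// mulrA divff ?mul1r// gt_eqF.
    rewrite ler_pM2l//; apply: daniell_le_fun => //; first exact: bcontZ.
      move=> x; rewrite mulr_ge0 ?invr_ge0 ?(ltW d0)// le_min (ltW d0) andbT.
      by case/andP: (f0 x).
    move=> x /=; rewrite lt_max ltxx orbF subr_gt0 => /ltW dfx.
    by rewrite min_r// mulVf// gt_eqF.
  have h3 : I (fun x => Num.min (f x) d) <= d * daniell L [set x | 0 < f x].
    rewrite -ind; last exact: posop.
    have iG : mu.-integrable setT (EFin \o (\1_[set x | 0 < f x] : borel E ->
      R)).
      by apply: integrable_indic => //; apply: sub_sigma_algebra; exact: posop.
    rewrite -RintegralZl//; apply: le_Rintegral => //.
    - exact: bcont_integrable.
    - by have := integrableZl measurableT d iG; apply: eq_integrable.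
    - move=> x _; have [fx|fx] := boolP (x \in [set x | 0 < f x]).
        by rewrite mulr1 ge_min lexx orbT.
      by move: fx; rewrite notin_setE/= mulr0 ge_min leNgt => /negP ->.
  by move: h1 h2 h3; rewrite -/(I _); lra.
have IL f : bcont f -> I f <= L f.
  move=> bf; have /bcontP[_ [M fM]] := bf; apply/ler_addgt0Pr => e e0.
  (* The shift gives values in [[0, M + M]], covered by the chosen number of slices of height [e];
     as [daniell] is at most 1, the error is at most [e]. *)
  have bfM : bcont (fun x => f x + M) by apply: bcontD => //; exact: bcont_cst.
  have := key e e0 (Num.truncn ((M + M) / e)).+1 _ bfM.
  rewrite !pfunctionalD ?pfunctional_cst//; try exact: bcont_cst.
  have d1 : e * daniell L [set x | 0 < f x + M] <= e.
    by rewrite ler_piMr ?(ltW e0)// daniell_le//; exact: daniell_cost1.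
  move=> /(_ _)/wrap[]; last by move: d1; lra.
  move=> x; have := fM x; rewrite ler_norml => /andP[f1 f2]; apply/andP; split;
    first by lra.
  have : M + M <= (Num.truncn ((M + M) / e)).+1%:R * e.
    by rewrite -ler_pdivrMr// ltW// truncnS_gt.
  by move: f2; lra.
move=> f bf; apply/eqP; rewrite eq_le IL//= -lerN2 -!pfunctionalN//.
by apply: IL; exact: bcontN.
Qed.

End riesz.

(** * Weak compactness *)

Section weak_compactness.
Variables (R : realType) (E : ptopologicalType).
Local Notation BC := (bounded_continuous R E).
Local Notation FS := {ptws BC -> R}.

(* Functionals live on the index type [BC] of the weak topology; the value at
   functions that are not bounded continuous is the junk value 0. *)
Definition total_ext (L : BC -> R) (f : E -> R) : R :=
  if pselect (bcont f) is left bf then L (exist _ f bf) else 0.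

Lemma total_extE (L : BC -> R) (f : E -> R) (bf : bcont f) :
  total_ext L f = L (exist _ f bf).
Proof.
rewrite /total_ext; case: pselect => // bf'.
by congr (L (exist _ f _)); exact: Prop_irrelevance.
Qed.

Lemma total_ext_sval (L : BC -> R) (f : BC) : total_ext L (sval f) = L f.
Proof. by case: f => f bf /=; rewrite (total_extE L bf). Qed.

Definition states : set FS := [set L | pfunctional (total_ext L)].

Lemma total_ext_integrals (mu : strategy R E) (f : E -> R) : bcont f ->
  total_ext (integrals mu) f = Rintegral mu setT f.
Proof. by move=> bf; rewrite (total_extE _ bf). Qed.

Lemma integrals_states (mu : strategy R E) : states (integrals mu).
Proof.
have [ID IZ I0 I1] := pfunctional_Rintegral mu.
split.
- move=> f g bf bg; rewrite !total_ext_integrals//; last exact: bcontD.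
  exact: ID.
- by move=> r f bf; rewrite !total_ext_integrals//; [exact: IZ|exact: bcontZ].
- by move=> f bf f0; rewrite total_ext_integrals//; exact: I0.
- by rewrite total_ext_integrals//; exact: bcont_cst.
Qed.

Lemma eval_continuous (f : E -> R) :
  continuous (fun L : FS => total_ext L f).
Proof.
rewrite /total_ext; case: pselect => [bf|_]; last exact: cst_continuous.
exact: (@proj_continuous BC (fun=> R) (exist _ f bf)).
Qed.

Lemma closed_eval_le (f : E -> R) r : closed [set L : FS | total_ext L f <= r].
Proof.
apply: (@closed_comp _ _ (fun L : FS => total_ext L f) [set x | x <= r]).
  by move=> L _; exact: eval_continuous.
exact: closed_le.
Qed.

(** Each clause of [pfunctional] compares finitely many evaluations, and evaluations are continuous
    for pointwise convergence. *)
Lemma closed_states : closed states.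
Proof.
have closed_eq0 (u : FS -> R) : continuous u -> closed [set L | u L = 0].
  by move=> cu; apply: (@closed_comp _ _ u [set 0]) => [L _|];
    [exact: cu|exact: closed_eq].
have closure_eq0 (u : FS -> R) : continuous u -> (forall L,
  states L -> u L = 0) ->
    forall L, closure states L -> u L = 0.
  move=> cu su L cL; have /closure_id := closed_eq0 u cu.
  move=> uE; suff : [set L | u L = 0] L by [].
  by rewrite uE; apply: closure_subset cL => K /su.
move=> L cL; split.
- move=> f g bf bg; apply/eqP; rewrite -subr_eq0; apply/eqP.
  apply: (closure_eq0 (fun L : FS => total_ext L (fun x =>
    f x + g x) - (total_ext L f + total_ext L g))) cL.
    by apply: continuous_add; [|apply/continuous_opp/continuous_add];
      exact: eval_continuous.
  by move=> K pK; rewrite pfunctionalD// subrr.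
- move=> r f bf; apply/eqP; rewrite -subr_eq0; apply/eqP.
  apply: (closure_eq0 (fun L : FS => total_ext L (fun x =>
    r * f x) - r * total_ext L f)) cL.
    apply: continuous_add; [|apply/continuous_opp/continuous_mul];
      try exact: eval_continuous.
    exact: cst_continuous.
  by move=> K pK; rewrite pfunctionalZ// subrr.
(* Positivity is rephrased as [L (- f) <= 0], a closed condition by [closed_eval_le]; the identity
   [L (- f) = - L f] passes to the closure separately. *)
- move=> f bf f0; rewrite -oppr_le0 -mulN1r.
  have /closure_id cE := @closed_eval_le (fun x => - f x) 0.
  have : [set L : FS | total_ext L (fun x => - f x) <= 0] L.
    rewrite cE; apply: closure_subset cL => K sK /=.
    by rewrite pfunctionalN// oppr_le0 pfunctional_ge0.
  move=> /=; rewrite mulN1r.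
  suff -> : total_ext L (fun x => - f x) = - total_ext L f by [].
  apply/eqP; rewrite -subr_eq0; apply/eqP.
  apply: (closure_eq0 (fun L : FS => total_ext L (fun x =>
    - f x) - - total_ext L f)) cL.
    by apply: continuous_add; [|do 2 apply: continuous_opp];
      exact: eval_continuous.
  by move=> K pK; rewrite pfunctionalN// subrr.
- apply/eqP; rewrite -subr_eq0; apply/eqP.
  apply: (closure_eq0 (fun L : FS => total_ext L (fun=> 1) - 1)) cL.
    by apply: continuous_add; [exact: eval_continuous|exact: cst_continuous].
  by move=> K pK; rewrite pfunctional_cst// subrr.
Qed.

(** As in the Banach-Alaoglu theorem, positivity and normalization confine [L f] to [[- M f, M f]],
    and a product of segments is compact. *)
Lemma compact_states : compact states.
Proof.
have bnd (f : BC) : exists M, forall x, `|sval f x| <= M.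
  by case: f => f /= /bcontP[].
pose M f := sval (cid (bnd f)).
have fM f x : `|sval f x| <= M f by rewrite /M; case: cid.
apply: (@subclosed_compact _ _ [set L : FS | forall f : BC, `[- M f,
  M f]%classic (L f)]).
- exact: closed_states.
- apply: (@tychonoff BC (fun=> R) (fun f => `[- M f, M f]%classic)) => f.
  exact: segment_compact.
- move=> L sL f /=; rewrite in_itv/= -(total_ext_sval L f).
  have bf := svalP f.
  rewrite -{1}(pfunctional_cst sL (- M f)) -[in X in _ && (_ <=
    X)](pfunctional_cst sL (M f)).
  apply/andP; split; apply: pfunctional_le => //; try exact: bcont_cst.
    by move=> x; have := fM f x; rewrite ler_norml => /andP[].
  by move=> x; have := fM f x; rewrite ler_norml => /andP[].
Qed.

(** The sets [C D] of states obeying the constraints in [D] form a filter base; a cluster point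
    obeys every constraint, each being closed. *)
Lemma states_finI (I : choiceType) (F : I -> E -> R) (r : I -> R) :
  (forall D : {fset I}, exists L, states L /\
    forall i, i \in D -> total_ext L (F i) <= r i) ->
  exists L, states L /\ forall i, total_ext L (F i) <= r i.
Proof.
move=> fin.
pose C (D : {fset I}) : set FS :=
  states `&` [set L | forall i, i \in D -> total_ext L (F i) <= r i].
have PF : ProperFilter (filter_from [set: {fset I}] C).
  apply: filter_from_proper; last by move=> D _; exact: fin.
  apply: filter_fromT_filter; first by exists fset0.
  move=> D D'; exists (D `|` D')%fset => L [sL LD].
  by split; split => // i iD; apply: LD; rewrite in_fsetU iD ?orbT.
have [|L [sL cL]] := compact_states PF; first by exists fset0 => // L [].
exists L; split => // i.
suff : closure [set L : FS | total_ext L (F i) <= r i] L.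
  by have /closure_id <- := @closed_eval_le (F i) (r i).
move=> U; apply: cL; exists [fset i]%fset => // K [_ /(_ i)]; apply.
by rewrite in_fset1.
Qed.

(** A filter on [S] is pushed to the states; its cluster point still obeys the constraints, hence is
    tight and represented by a strategy. That strategy is a cluster point of the original filter
    because the weak topology is initial for [integrals]. *)
Lemma compact_strategies (cE : cozero_opens R E) (S : set (strategy R E))
    (I : Type) (F : I -> E -> R) (r : I -> R) :
  (forall i, bcont (F i)) ->
  (forall mu, S mu <-> forall i, Rintegral mu setT (F i) <= r i) ->
  (forall L, pfunctional L -> (forall i,
    L (F i) <= r i) -> tight_functional L) ->
  compact S.
Proof.
move=> bF SE tF Fil PF FS.
pose T := states `&` [set L | forall i, total_ext L (F i) <= r i].
have cT : compact T.
  apply: (subclosed_compact _ compact_states); last exact: subIsetl.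
  apply: closedI; first exact: closed_states.
  rewrite (_ : [set L | _] = \bigcap_i [set L | total_ext L (F i) <= r i]).
    by apply: closed_bigI => i _; exact: closed_eval_le.
  by apply/seteqP; split => L LF i => [_|]; [exact: LF|exact: LF i Logic.I].
have FT : fmap (@integrals R E) Fil T.
  rewrite /fmap; apply: (@filterS _ Fil _ S) FS => nu /SE nuS.
  by split => [|i]; [exact: integrals_states|rewrite total_ext_integrals].
have [L [[sL LF] clL]] := cT _ (fmap_proper_filter _ PF) FT.
have [mu muL] := riesz_representation cE sL (tF _ sL LF).
have muE : integrals mu = L.
  by apply/funext => f; rewrite -[RHS]total_ext_sval -muL//; exact: svalP.
exists mu; split.
  by apply/SE => i; rewrite muL.
move=> A B FA [_ [[U oU <-] Umu] UB].
have [K [[nu Anu <-] Unu]] : (@integrals R E @` A) `&` U !=set0.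
  apply: clL.
    rewrite /fmap; apply: (@filterS _ Fil _ A) FA; exact: preimage_image.
  by apply: open_nbhs_nbhs; split => //; rewrite -muE.
by exists nu; split => //; exact: UB.
Qed.

End weak_compactness.

(** * Approachability *)

Section approachability.
Variables (R : realType) (B : Type) (I : finType) (u : I -> B -> R).
Variable M : R.
Hypothesis uM : forall i b, `|u i b| <= M.
Hypothesis response : forall w : I -> R, (forall i, 0 <= w i) ->
  exists b, 0 <= \sum_i w i * u i b.

(* Blackwell's strategy: answering the weights given by the negative parts of
   the cumulative payoffs makes their squared norm grow at most linearly. *)
Lemma approachability_potential n : exists s : seq B, size s = n /\
  \sum_i (Num.max (- \sum_(b <- s) u i b) 0) ^+ 2 <= n%:R * (#|I|%:R * M ^+ 2).
Proof.
elim: n => [|n [s [<- IH]]].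
  by exists [::]; split=> //; rewrite big1 ?mul0r// => i _;
    rewrite big_nil oppr0 maxxx expr0n.
set N := fun i => Num.max (- \sum_(b <- s) u i b) 0 in IH *.
have N0 i : 0 <= N i by rewrite /N le_max lexx orbT.
have [b Nb] := response N0.
exists (b :: s); split => //=.
(* The cross term [- 2 * \sum_i N i * u i b] is nonpositive by the choice of [b], which leaves a
   growth of at most [#|I| * M ^+ 2]. *)
apply: (@le_trans _ _ (\sum_i (N i ^+ 2 + (M ^+ 2 - 2 * (N i * u i b))))).
  apply: ler_sum => i _; rewrite big_cons.
  have : Num.max (- (u i b + \sum_(j <- s) u i j)) 0 <= Num.max (N i - u i b) 0.
    rewrite ge_max !le_max lexx orbT andbT; apply/orP; left.
    by rewrite opprD addrC lerD2r /N le_max lexx.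
  set x := Num.max _ _; set y := Num.max _ _ => xy.
  have x0 : 0 <= x by rewrite le_max lexx orbT.
  apply: (@le_trans _ _ (y ^+ 2));
    first by rewrite ler_sqr ?nnegrE// (le_trans x0).
  have : u i b ^+ 2 <= M ^+ 2.
    by rewrite -[leLHS]real_normK ?num_real// lerXn2r ?nnegrE// (le_trans _ (uM
      i b)).
  have : y ^+ 2 <= (N i - u i b) ^+ 2.
    rewrite /y; case: (leP (N i - u i b) 0) => // _.
    by rewrite expr0n; exact: sqr_ge0.
  by rewrite sqrrB; move: (N i * u i b) (u i b ^+ 2) => ? ?; lra.
rewrite !big_split/= sumrN sumr_const -[#|_|]/#|I| -(mulr_natl (M ^+ 2))
  -mulr_sumr.
by rewrite -[in leRHS]addn1 natrD mulrDl mul1r; lra.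
Qed.

(** With [K = #|I| * M ^+ 2], a negative cumulative payoff after [n] rounds has absolute value at
    most the square root of [n * K], which is at most [e * n] once [n >= K / e ^+ 2]. *)
Lemma approachability e : 0 < e -> exists s : seq B, (0 < size s)%N /\
  forall i, - (e * (size s)%:R) <= \sum_(b <- s) u i b.
Proof.
move=> e0; pose K := #|I|%:R * M ^+ 2.
have [s [ss]] := approachability_potential (Num.truncn (K / e ^+ 2)).+1.
rewrite -ss => pot; exists s; split; first by rewrite ss.
have Ks : K <= e ^+ 2 * (size s)%:R.
  by rewrite mulrC -ler_pdivrMr ?exprn_gt0// ss ltW// truncnS_gt.
move=> i; rewrite lerNl; set S := - _; have [S0|S0] := leP S 0.
  by rewrite (le_trans S0)// mulr_ge0// ltW.
rewrite -(@ler_sqr _ S) ?nnegrE; [|exact: ltW|by rewrite mulr_ge0// ltW].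
apply: (@le_trans _ _ ((size s)%:R * K)).
  apply: le_trans pot; rewrite (bigD1 i)//= -/S max_l ?(ltW S0)// lerDl.
  by apply: sumr_ge0 => j _; exact: sqr_ge0.
rewrite (_ : (_ * _) ^+ 2 = (size s)%:R * (e ^+ 2 * (size s)%:R)); last by ring.
by rewrite ler_wpM2l.
Qed.

End approachability.

(** * From finite weightings to a minimax state *)

Section finitely_supported.
Variables (R : realType) (E : ptopologicalType).

Lemma pfunctional_finite (I : Type) (s : seq I) (x : I -> E) (w : I -> R) :
  (forall i, 0 <= w i) -> \sum_(i <- s) w i = 1 ->
  pfunctional (fun f : E -> R => \sum_(i <- s) w i * f (x i)).
Proof.
move=> w0 w1; split.
- by move=> f g _ _; rewrite -big_split/=; apply: eq_bigr => i _;
    rewrite mulrDr.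
- by move=> r f _; rewrite mulr_sumr; apply: eq_bigr => i _; rewrite mulrCA.
- by move=> f _ f0; apply: sumr_ge0 => i _; rewrite mulr_ge0.
- by under eq_bigr do rewrite mulr1.
Qed.

(** The finite support is the compact set that witnesses tightness, so the representation theorem
    yields the measure together with its integrals. *)
Lemma finite_strategy (cE : cozero_opens R E) (I : choiceType) (D : {fset I})
    (x : I -> E) (w : I -> R) :
  (forall i, 0 <= w i) -> \sum_(i <- D) w i = 1 ->
  exists mu : strategy R E, forall f, bcont f ->
    Rintegral mu setT f = \sum_(i <- D) w i * f (x i).
Proof.
move=> w0 w1; apply: (riesz_representation cE (pfunctional_finite x w0 w1)) =>
  e e0.
exists (x @` [set` D]); split; first by apply: finite_compact;
  exact/finite_image.
move=> f _ _ f1; apply: (@le_trans _ _ 1); first by rewrite lerBlDr lerDl ltW.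
rewrite -w1 big_seq [leRHS]big_seq; apply: ler_sum => i iD.
by rewrite ler_peMr// f1//; exists i.
Qed.

Lemma pfunctional_states (L : (E -> R) -> R) : pfunctional L ->
  exists2 K, states K & forall f, bcont f -> @total_ext R E K f = L f.
Proof.
move=> pL; pose K (f : bounded_continuous R E) := L (sval f).
have KE f : bcont f -> total_ext K f = L f by move=> bf;
  rewrite (total_extE _ bf).
exists K => //; split.
- by move=> f g bf bg; rewrite !KE ?(pfunctionalD pL)//; exact: bcontD.
- by move=> r f bf; rewrite !KE ?(pfunctionalZ pL)//; exact: bcontZ.
- by move=> f bf f0; rewrite KE//; exact: pfunctional_ge0.
- by rewrite KE ?(pfunctional_cst pL)//; exact: bcont_cst.
Qed.

(** Each constraint is replaced by the countably many bounds [r + 1 / (n + 1)]; a finite set of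
    pairs [(i, n)] involves finitely many [i], and its largest [n] gives the slack to ask for. *)
Lemma states_finI_approx (I : choiceType) (F : I -> E -> R) (r : R) :
  (forall (D : {fset I}) (e : R), 0 < e -> exists L, states L /\
    forall i, i \in D -> @total_ext R E L (F i) <= r + e) ->
  exists L, states L /\ forall i, @total_ext R E L (F i) <= r.
Proof.
move=> fin.
have [|L [sL LF]] := @states_finI R E (I * nat)%type (fun i => F i.1) (fun i =>
  r + i.2.+1%:R^-1).
  move=> D; have [|L [sL LD]] := fin [fset i.1 | i in D]%fset (\max_(i <- D)
    i.2).+1%:R^-1.
    by rewrite invr_gt0.
  exists L; split => // -[i n] inD /=; apply: le_trans (LD i _) _.
    by apply/imfsetP; exists (i, n).
  rewrite lerD2l lef_pV2 ?posrE// ler_nat ltnS.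
  exact: (@leq_bigmax_seq _ (enum_fset D) xpredT snd (i, n) inD isT).
exists L; split => // i; apply/ler_addgt0Pr => e e0.
apply: le_trans (LF (i, Num.truncn e^-1)) _; rewrite lerD2l/= invf_ple ?posrE//.
by rewrite ltW// truncnS_gt.
Qed.

(* The strategies of the player who maximizes [F i] over [E] are here replaced
   by states; finitely many payoffs are handled by approachability and the
   passage to all of them by compactness. *)
Lemma minimax_states (I : choiceType) (F : I -> E -> R) (v : R) :
  (forall i, bcont (F i)) ->
  (forall (D : {fset I}) (w : I -> R) (e : R), (forall i, 0 <= w i) -> 0 < e ->
    \sum_(i <- D) w i = 1 -> exists x, v - e <= \sum_(i <- D) w i * F i x) ->
  exists L, states L /\ forall i, v <= @total_ext R E L (F i).
Proof.
move=> bF resp.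
have [D e e0|L [sL LF]] := @states_finI_approx I (fun i x => - F i x) (- v);
  last first.
  exists L; split => // i; have := LF i.
  by rewrite (pfunctionalN sL)// lerN2.
(* Payoffs are centred at [v - e / 2]: one half of [e] is lost to [resp], the other to
   approachability. *)
have [M uM] : exists M : R, forall (i : D) x, `|F (val i) x - (v - e / 2)| <= M.
  have h (i : D) : exists M : R, forall x, `|F (val i) x - (v - e / 2)| <= M.
    by have /bcontP[_] := bcontB (bF (val i)) (bcont_cst _ (v - e / 2)).
  pose m i := sval (cid (h i)); exists (\sum_i `|m i|) => i x.
  apply: (@le_trans _ _ (m i)); first by rewrite /m; case: cid.
  by rewrite (bigD1 i)//= (le_trans (ler_norm _))// lerDl sumr_ge0.
have rsp (w : D -> R) : (forall i, 0 <= w i) ->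
    exists x, 0 <= \sum_i w i * (F (val i) x - (v - e / 2)).
  move=> w0; have t0 : 0 <= \sum_i w i by exact: sumr_ge0.
  move: t0; rewrite le_eqVlt => /predU1P[/esym t0|].
    exists point; rewrite big1// => i _.
    suff -> : w i = 0 by rewrite mul0r.
    by have /eqP := t0; rewrite psumr_eq0// =>
      /allP/(_ i (mem_index_enum _))/eqP.
  set t := \sum_i w i => t0.
  (* The weights are extended by 0 outside [D] and normalized, as [resp] asks for total weight 1. *)
  pose w' i := oapp w 0 (insub i) / t.
  have w'E (i : D) : w' (val i) = w i / t by rewrite /w' valK.
  have [i|||x] := resp D w' (e / 2).
  - by rewrite divr_ge0 ?(ltW t0)//; case: insub => /=.
  - by rewrite divr_gt0.
  - rewrite big_seq_fsetE/=; under eq_bigr do rewrite w'E.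
    by rewrite -mulr_suml divff// gt_eqF.
  rewrite big_seq_fsetE/= => wx; exists x.
  under eq_bigr do rewrite mulrBr; rewrite sumrB -mulr_suml -/t.
  have -> : \sum_(i : D) w i * F (val i) x = t * \sum_(i : D) w' (val i) * F
    (val i) x.
    rewrite mulr_sumr; apply: eq_bigr => i _; rewrite w'E.
    by field; rewrite gt_eqF.
  by rewrite -mulrBr mulr_ge0 ?subr_ge0// ltW.
have [s [s0 ss]] := approachability uM rsp (divr_gt0 e0 (ltr0n R 2)).
have n0 : 0 < (size s)%:R :> R by rewrite ltr0n.
have n1 : \sum_(b <- s) (size s)%:R^-1 = 1 :> R.
  by rewrite big_const_seq count_predT iter_addr_0 -[LHS]mulr_natr mulVf//
    gt_eqF.
have nge0 (b : E) : 0 <= (size s)%:R^-1 :> R by rewrite invr_ge0 ltW.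
have [L sL LE] := pfunctional_states (pfunctional_finite id nge0 n1).
exists L; split => // i iD; rewrite LE; last exact: bcontN.
have := ss [` iD]%fset; rewrite /= sumrB -mulr_sumr sumrN.
rewrite big_const_seq count_predT iter_addr_0 -(mulr_natr (v - e / 2)) => h.
rewrite -(@ler_pM2l _ (size s)%:R)// mulrA divff ?mul1r ?gt_eqF//.
by clear -h; move: h; set S := \sum_(_ <- s) _; set n := (size s)%:R; lra.
Qed.

End finitely_supported.

Section mixture_integral.
Variables (R : realType) (E : ptopologicalType).

Lemma ge0_Rintegral_mixture (t : {i01 R}) (mu nu : strategy R E) (f : E -> R) :
  bcont f -> (forall x, 0 <= f x) ->
  Rintegral (mixture t mu nu : strategy R E) setT f =
  t%:num * Rintegral mu setT f + (1 - t%:num) * Rintegral nu setT f.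
Proof.
move=> bf f0; rewrite /Rintegral /mixture.
have mf : measurable_fun setT (EFin \o (f : borel E -> R)).
  by apply/measurable_EFinP; exact: (continuous_measurable (proj1 bf)).
rewrite ge0_integral_measure_add//; last by move=> x _; rewrite lee_fin.
rewrite !ge0_integral_mscale//; try by move=> x _; rewrite lee_fin.
have fin (m : strategy R E) : (\int[m]_x (f x)%:E)%E \is a fin_num.
  by apply: integrable_fin_num => //; exact: bcont_integrable.
by rewrite fineD ?fin_numM ?fineM ?fin//; exact: fin.
Qed.

(** Adding a bound [M] of [f] reduces to a nonnegative function; the constant contributes [M] on
    both sides, as the weights sum to 1. *)
Lemma Rintegral_mixture (t : {i01 R}) (mu nu : strategy R E) (f : E -> R) :
  bcont f ->
  Rintegral (mixture t mu nu : strategy R E) setT f =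
  t%:num * Rintegral mu setT f + (1 - t%:num) * Rintegral nu setT f.
Proof.
move=> bf; have /bcontP[_ [M fM]] := bf.
have bM := bcont_cst E M.
have := ge0_Rintegral_mixture t mu nu (bcontD bf bM).
rewrite !(pfunctionalD (pfunctional_Rintegral _))// !(pfunctional_cst
  (pfunctional_Rintegral _)).
move=> /(_ _)/wrap[]; last by lra.
by move=> x; have := fM x; rewrite ler_norml => /andP[]; lra.
Qed.

End mixture_integral.

(** * Games with a compact maximizer *)

Section game_value.
Variables (R : realType) (A B : ptopologicalType) (c : A * B -> R) (m : R).
Hypotheses (m_le0 : m <= 0) (mc : forall z, m <= c z).
Hypothesis cA : forall b, continuous (fun a => c (a, b)).
Hypothesis cB : forall a, continuous (fun b => c (a, b)).
Hypothesis compactB : compact [set: B].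
Hypothesis compactA : exists b, forall r, compact [set a | c (a, b) <= r].
Hypotheses (zA : cozero_opens R A) (zB : cozero_opens R B).
Hypothesis mc_prod : measurable_fun setT (c : (borel A * borel B)%type -> R).

Implicit Types (mu : strategy R A) (nu : strategy R B).
Local Open Scope ereal_scope.

(** * Payoffs as iterated integrals of nonnegative functions *)

Lemma integral_addr (E : ptopologicalType) (mu : strategy R E)
    (q : borel E -> \bar R) (K r : R) :
  measurable_fun setT q -> (forall x, 0 <= q x <= K%:E) ->
  \int[mu]_x (q x + r%:E) = \int[mu]_x q x + r%:E.
Proof.
move=> mq qK; rewrite integralD//.
- by rewrite integral_cst// [X in _ + _ * X](probability_setT mu) mule1.
- apply/integrableP; split => //.
  apply: (@le_lt_trans _ _ (\int[mu]_x (cst K%:E x))).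
    apply: ge0_le_integral => //.
    - exact: measurableT_comp.
    - by move=> x _; case/andP: (qK x) => q0 qk; rewrite gee0_abs.
  by rewrite integral_cst// [X in _ * X](probability_setT mu) mule1 ltry.
- by apply/integrableP; split => //;
    rewrite integral_cst// [X in _ * X](probability_setT mu) mule1 ltry.
Qed.

Lemma bcont_payoff a : bcont (fun b => c (a, b)).
Proof.
apply/bcontP; split; first exact: cB.
have cc : compact ((fun b => c (a, b)) @` [set: B]).
  by apply: continuous_compact compactB; exact/continuous_subspaceT/cB.
have [M [_ cM]] := compact_bounded cc.
by exists (M + 1)%R => b; apply: (cM (M + 1)%R); rewrite ?ltrDl//; exists b.
Qed.

(** After the shift by the lower bound, Tonelli's theorem and monotone convergence apply even when
    the integrals are infinite. *)
Let k (z : A * B) : R := (c z - m)%R.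
Let k_ge0 z : (0 <= k z)%R. Proof. by rewrite subr_ge0. Qed.

Definition payoff mu nu : \bar R := \int[mu]_a \int[nu]_b (k (a, b))%:E.

Let neg (z : A * B) : R := (Num.min (c z) 0 - m)%R.
Let neg0 z : (0 <= neg z)%R.
Proof. by rewrite subr_ge0 le_min mc. Qed.
Let negm z : (neg z <= - m)%R.
Proof. by rewrite /neg -[leRHS]add0r lerD2r ge_min lexx orbT. Qed.

Let kE0 z : 0 <= (k z)%:E. Proof. by rewrite lee_fin. Qed.
Let negE0 z : 0 <= (neg z)%:E. Proof. by rewrite lee_fin. Qed.
Let posE0 z : 0 <= (Num.max (c z) 0)%:E.
Proof. by rewrite lee_fin le_max lexx orbT. Qed.

Let mkp : measurable_fun setT (fun z : borel A * borel B => (k z)%:E).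
Proof. by apply/measurable_EFinP; apply: measurable_funB. Qed.

Let mneg : measurable_fun setT (fun z : borel A * borel B => (neg z)%:E).
Proof.
apply/measurable_EFinP; apply: measurable_funB => //.
exact: (measurable_minr mc_prod (measurable_cst _)).
Qed.

Let mpos : measurable_fun setT (fun z : borel A * borel B =>
  (Num.max (c z) 0)%:E).
Proof.
by apply/measurable_EFinP; exact: (measurable_maxr mc_prod (measurable_cst _)).
Qed.

Let msecA (F : A * B -> \bar R) a :
  measurable_fun setT (F : (borel A * borel B)%type -> \bar R) ->
  measurable_fun setT (fun b : borel B => F (a, b)).
Proof.
move=> mF.
exact: (measurableT_comp mF (pair1_measurable (a : borel A))).
Qed.

Lemma chat_minusE mu nu :
  chat_minus c mu nu = \int[mu]_a \int[nu]_b (neg (a, b))%:E + m%:E.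
Proof.
have negB a : measurable_fun setT (fun b : borel B => (neg (a, b))%:E).
  exact: (msecA a mneg).
rewrite -(@integral_addr _ mu _ (- m)).
- apply: eq_integral => a _; rewrite -(@integral_addr _ nu _ (- m))//.
  + by apply: eq_integral => b _; rewrite -EFinD subrK.
  + by move=> b; rewrite !lee_fin neg0 negm.
- exact: (measurable_fun_fubini_tonelli_F _ mneg negE0).
- move=> a; rewrite integral_ge0/=; last by move=> b _; rewrite lee_fin.
  apply: (@le_trans _ _ (\int[nu]_b (cst (- m)%:E b))).
    by apply: ge0_le_integral => // b _; rewrite lee_fin.
  by rewrite integral_cst// [X in _ * X](probability_setT nu) mule1.
Qed.

(** [c - m] is the sum of [max c 0] and [min c 0 - m], both nonnegative, so their iterated integrals
    add up even if infinite. *)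
Lemma chatE mu nu : chat c mu nu = payoff mu nu + m%:E.
Proof.
rewrite /chat chat_minusE addeA; congr (_ + _).
have int0 (F : A * B -> \bar R) a : (forall z, 0 <= F z) ->
  0 <= \int[nu]_b F (a, b) by move=> F0; exact: integral_ge0.
rewrite /chat_plus /payoff -ge0_integralD//.
- apply: eq_integral => a _; rewrite -ge0_integralD//.
  + apply: eq_integral => b _; rewrite -EFinD; congr (_%:E).
    by rewrite /neg /k; case: (leP (c (a, b)) (0%R : R)) => _; lra.
  + exact: (msecA a mpos).
  + exact: (msecA a mneg).
- by move=> a _; exact: (int0 (fun z => (Num.max (c z) 0)%:E)).
- exact: (measurable_fun_fubini_tonelli_F _ mpos posE0).
- by move=> a _; exact: (int0 (fun z => (neg z)%:E)).
- exact: (measurable_fun_fubini_tonelli_F _ mneg negE0).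
Qed.

(** [min c 0] is at least [m], so the negative part of the payoff is finite; hence [PS_A] and [PS_B]
    contain all strategies. *)
Lemma chat_definedT mu nu : chat_defined c mu nu.
Proof.
right; rewrite chat_minusE; apply: (@lt_le_trans _ _ m%:E); first exact: ltNyr.
rewrite leeDr// integral_ge0// => a _; apply: integral_ge0 => b _.
by rewrite lee_fin.
Qed.

Lemma chat_pointB mu b :
  chat c mu (point_mass R b) = \int[mu]_a (k (a, b))%:E + m%:E.
Proof.
rewrite chatE; congr (_ + _); apply: eq_integral => a _.
rewrite integral_dirac//; last exact: (msecA a mkp).
by rewrite diracT mul1e.
Qed.

Lemma chat_pointA a nu :
  chat c (point_mass R a) nu = \int[nu]_b (k (a, b))%:E + m%:E.
Proof.
rewrite chatE; congr (_ + _); rewrite /payoff integral_dirac//.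
  by rewrite diracT mul1e.
exact: (measurable_fun_fubini_tonelli_F _ mkp kE0).
Qed.

(** Tonelli's theorem moves the integral over [a] inside; what remains is an average over [b] of
    payoffs against points, each at most [w]. *)
Lemma P_sharp_chat mu nu w : P_sharp c w mu -> chat c mu nu <= w%:E.
Proof.
move=> muw; rewrite chatE /payoff (fubini_tonelli _ mkp kE0).
rewrite -leeBrDr//.
apply: (@le_trans _ _ (\int[nu]_b (cst (w%:E - m%:E) b))).
  apply: ge0_le_integral => //.
  - by move=> b _; apply: integral_ge0 => a _; rewrite lee_fin.
  - exact: (measurable_fun_fubini_tonelli_G _ mkp kE0).
  - move=> b _; rewrite leeBrDr// -chat_pointB.
    by apply: le_trans muw; apply: ereal_sup_ubound; exists b.
by rewrite integral_cst// [X in _ * X](probability_setT nu) mule1.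
Qed.

Lemma P_flat_chat mu nu w : P_flat c w nu -> w%:E <= chat c mu nu.
Proof.
move=> nuw; rewrite chatE /payoff -leeBlDr//.
have [wm|mw] := leP w m.
  apply: (@le_trans _ _ 0); first by rewrite -EFinB lee_fin subr_le0.
  by apply: integral_ge0 => a _; apply: integral_ge0 => b _; rewrite lee_fin.
rewrite [leLHS](_ : _ = \int[mu]_a (cst (w%:E - m%:E) a)); last first.
  by rewrite integral_cst// [X in _ * X](probability_setT mu) mule1.
apply: ge0_le_integral => //.
- by move=> a _; rewrite -EFinB lee_fin subr_ge0 ltW.
- exact: (measurable_fun_fubini_tonelli_F _ mkp kE0).
- move=> a _; rewrite leeBlDr// -chat_pointA.
  by apply: le_trans nuw _; apply: ereal_inf_lbound; exists a.
Qed.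

(** The height [m + n] keeps the truncation above [m], so that after subtraction of [m] it is
    nonnegative and increases to [k] with [n]. *)
Definition truncated_payoff (i : B * nat) (a : A) : R :=
  Num.min (c (a, i.1)) (m + i.2%:R)%R.

Lemma truncated_payoff_ge i a : (m <= truncated_payoff i a)%R.
Proof. by rewrite /truncated_payoff le_min mc lerDl ler0n. Qed.

Lemma bcont_truncated_payoff i : bcont (truncated_payoff i).
Proof.
apply/bcontP; split.
  by apply: continuous_min; [exact: cA|exact: cst_continuous].
exists (`|m| + i.2%:R)%R => a; rewrite ler_norml; apply/andP; split.
  apply: le_trans (truncated_payoff_ge i a); rewrite lerNl.
  by rewrite -normrN (le_trans (ler_norm _))// lerDl ler0n.
by rewrite /truncated_payoff ge_min lerD2r ler_norm orbT.
Qed.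

Lemma EFin_Rintegral (E : ptopologicalType) (mu : strategy R E) (f : E -> R) :
  bcont f -> (Rintegral mu setT f)%:E = \int[mu]_x (f x)%:E.
Proof.
move=> bf; rewrite /Rintegral fineK//.
by apply: integrable_fin_num => //; exact: bcont_integrable.
Qed.

(** Monotonicity gives one direction, monotone convergence the other. The set becomes an
    intersection of weakly closed half-spaces, the form used for compactness and convexity. *)
Lemma P_sharpE w mu : P_sharp c w mu <->
  forall i, (Rintegral mu setT (truncated_payoff i) <= w)%R.
Proof.
pose g b (n : nat) a := (truncated_payoff (b, n) a - m)%R.
have g0 b n a : (0 <= g b n a)%R by rewrite subr_ge0 truncated_payoff_ge.
have bg b n : bcont (g b n).
  by apply: bcontB; [exact: bcont_truncated_payoff|exact: bcont_cst].
have gE b n : \int[mu]_a (g b n a)%:E + m%:E =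
    (Rintegral mu setT (truncated_payoff (b, n)))%:E.
  rewrite -EFin_Rintegral// -EFinD; congr (_%:E).
  have pI := pfunctional_Rintegral mu.
  rewrite (pfunctionalB pI) ?(pfunctional_cst pI) ?subrK//.
    exact: bcont_truncated_payoff.
  exact: bcont_cst.
have mg b n : measurable_fun setT (fun a : borel A => (g b n a)%:E).
  by apply/measurable_EFinP; exact: (continuous_measurable (proj1 (bg b n))).
have mkb b : measurable_fun setT (fun a : borel A => (k (a, b))%:E).
  apply/measurable_EFinP;
    apply: (@continuous_measurable _ _ (fun a => k (a, b))).
  by apply: continuous_add; [exact: cA|exact: cst_continuous].
split=> [muw [b n]|muw].
  rewrite -lee_fin -gE.
  have : chat c mu (point_mass R b) <= w%:E.
    by apply: le_trans muw; apply: ereal_sup_ubound; exists b.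
  apply: le_trans; rewrite chat_pointB leeD2r//.
  apply: ge0_le_integral => //; try by move=> a _; rewrite lee_fin.
  by move=> a _; rewrite lee_fin /g /k lerD2r /truncated_payoff ge_min lexx.
apply: ge_ereal_sup => _ [b _ <-]; rewrite chat_pointB -leeBrDr//.
(* For each [a] the sequence is constant from the first integer above [k (a, b)] on. *)
have kE a : (k (a, b))%:E = limn (fun n => (g b n a)%:E).
  apply/esym/cvg_lim => //; apply: cvg_near_cst.
  exists (Num.truncn (k (a, b))).+1 => // n /= kn; congr (_%:E).
  rewrite /g /truncated_payoff min_l// -lerBlDl.
  by rewrite (le_trans (ltW (truncnS_gt _)))// ler_nat.
under eq_integral do rewrite kE.
have g0E n x : [set: borel A] x -> 0 <= (g b n x)%:E by rewrite lee_fin.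
have gnd x : [set: borel A] x -> {homo (fun n =>
  (g b n x)%:E) : p q / (p <= q)%N >-> p <= q}.
  move=> _ p q pq; rewrite lee_fin /g lerD2r /truncated_payoff le_min ge_min
    lexx/=.
  by rewrite ge_min lerD2l ler_nat pq orbT.
have cv := @cvg_monotone_convergence _ _ _ mu _ measurableT _ (mg b) g0E gnd.
rewrite -(cvg_lim _ cv)//; apply: lime_le; first by apply/cvg_ex; eexists;
  exact: cv.
by apply: nearW => n; rewrite leeBrDr// gE lee_fin.
Qed.

Lemma P_flatE w nu : P_flat c w nu <->
  forall a, (w <= Rintegral nu setT (fun b => c (a, b)))%R.
Proof.
have bk a : bcont (fun b => k (a, b)).
  by apply: bcontB; [exact: bcont_payoff|exact: bcont_cst].
have cE a : chat c (point_mass R a) nu = (Rintegral nu setT (fun b =>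
  c (a, b)))%:E.
  rewrite chat_pointA -(EFin_Rintegral nu (bk a)) -EFinD; congr (_%:E).
  have pI := pfunctional_Rintegral nu.
  rewrite (pfunctionalB pI) ?(pfunctional_cst pI) ?subrK//.
    exact: bcont_payoff.
  exact: bcont_cst.
split=> [nuw a|nuw].
  by rewrite -lee_fin -cE; apply: le_trans nuw _; apply: ereal_inf_lbound;
    exists a.
by apply: le_ereal_inf_tmp => _ [a _ <-]; rewrite cE lee_fin.
Qed.

Local Open Scope ring_scope.

Lemma tight_compactB (L : (B -> R) -> R) : pfunctional L -> tight_functional L.
Proof.
move=> pL e e0; exists setT; split => // f bf _ f1.
apply: (@le_trans _ _ 1); first by rewrite lerBlDr lerDl ltW.
rewrite -(pfunctional_cst pL 1); apply: pfunctional_le => //.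
  exact: bcont_cst.
by move=> x; exact: f1.
Qed.

(* Outside the compact set [c (a, b) <= m + n] the truncated payoff exceeds [m]
   by [n], so Markov's inequality gives it little mass. *)
Lemma tight_truncated_payoff w (L : (A -> R) -> R) : pfunctional L ->
  (forall i, L (truncated_payoff i) <= w) -> tight_functional L.
Proof.
move=> pL Lw e e0; have [b cK] := compactA.
pose n := (Num.truncn ((w - m) / e)).+1.
have n0 : 0 < n%:R :> R by rewrite ltr0n.
exists [set a | c (a, b) <= m + n%:R]; split => // f bf f0 f1.
have bt := bcont_truncated_payoff (b, n).
have bg : bcont (fun a => n%:R^-1 * (truncated_payoff (b, n) a - m)).
  by apply/bcontZ/bcontB => //; exact: bcont_cst.
(* Pointwise, [f] is at least 1 on the compact set, and the second term equals 1 off it. *)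
have : L (fun=> 1) <= L (fun a =>
  f a + n%:R^-1 * (truncated_payoff (b, n) a - m)).
  apply: pfunctional_le => //; [exact: bcont_cst|exact: bcontD|move=> a].
  have t0 : 0 <= n%:R^-1 * (truncated_payoff (b, n) a - m).
    by rewrite mulr_ge0 ?invr_ge0 ?ler0n// subr_ge0 truncated_payoff_ge.
  have [ca|ca] := leP (c (a, b)) (m + n%:R).
    by rewrite (le_trans (f1 a ca))// lerDl.
  rewrite /truncated_payoff/= (min_r (ltW ca)) [m + _]addrC addrK mulVf
    ?gt_eqF//.
  by rewrite lerDr.
rewrite (pfunctionalD pL)// (pfunctionalZ pL) ?(pfunctionalB pL)
  ?(pfunctional_cst pL)//;
  try exact: bcont_cst; last by apply: bcontB => //; exact: bcont_cst.
have : n%:R^-1 * (L (truncated_payoff (b, n)) - m) <= e.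
  rewrite mulrC ler_pdivrMr// mulrC (@le_trans _ _ (w - m))//.
    by rewrite lerD2r.
  by rewrite -ler_pdivrMr// ltW// truncnS_gt.
lra.
Qed.

Lemma compact_P_sharp w : compact (P_sharp c w).
Proof.
apply: (compact_strategies zA bcont_truncated_payoff (P_sharpE w)) => L pL.
exact: tight_truncated_payoff.
Qed.

Lemma compact_P_flat w : compact (P_flat c w).
Proof.
apply: (@compact_strategies _ _ zB _ A (fun a b => - c (a, b)) (fun=> - w)).
- by move=> a; exact/bcontN/bcont_payoff.
- move=> nu; split => [/P_flatE nuw a|nuw].
    by rewrite (pfunctionalN (pfunctional_Rintegral nu)) ?lerN2//;
      exact: bcont_payoff.
  apply/P_flatE => a; rewrite -lerN2.
  by rewrite -(pfunctionalN (pfunctional_Rintegral nu))//; exact: bcont_payoff.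
- by move=> L pL _; exact: tight_compactB.
Qed.

Lemma convex_P_sharp w : convex_strategies (P_sharp c w).
Proof.
move=> t mu mu' /P_sharpE muw /P_sharpE mu'w; apply/P_sharpE => i.
rewrite Rintegral_mixture; last exact: bcont_truncated_payoff.
have := muw i; have := mu'w i; have : 0 <= t%:num :> R by [];
  have : t%:num <= 1 :> R by [].
by nra.
Qed.

Lemma convex_P_flat w : convex_strategies (P_flat c w).
Proof.
move=> t nu nu' /P_flatE nuw /P_flatE nu'w; apply/P_flatE => a.
rewrite Rintegral_mixture; last exact: bcont_payoff.
have := nuw a; have := nu'w a; have : 0 <= t%:num :> R by [];
  have : t%:num <= 1 :> R by [].
by nra.
Qed.

(** The level is the infimum of the set [W] of levels that the minimizer can guarantee; it is finite
    since [W] is bounded below by [m] and contains a bound of [c (point, .)]. *)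
Lemma optimal_strategies :
  exists v, P_sharp c v !=set0 /\ P_flat c v !=set0.
Proof.
pose W := [set w | P_sharp c w !=set0].
have Wm w : W w -> m <= w.
  move=> [mu /P_sharpE muw]; apply: le_trans (muw (point, 0%N)).
  have pI := pfunctional_Rintegral mu.
  rewrite -(pfunctional_cst pI m); apply: (pfunctional_le pI).
  - exact: bcont_cst.
  - exact: bcont_truncated_payoff.
  - exact: truncated_payoff_ge.
have WfW (D : {fset A}) (p : A -> R) w : (forall a, 0 <= p a) ->
    \sum_(a <- D) p a = 1 -> (forall b, \sum_(a <- D) p a * c (a,
      b) <= w) -> W w.
  move=> p0 p1 pw; have [mu muE] := finite_strategy zA id p0 p1.
  exists mu; apply/P_sharpE => -[b n]; rewrite muE;
    last exact: bcont_truncated_payoff.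
  apply: le_trans (pw b); apply: ler_sum => a _; apply: ler_wpM2l => //.
  by rewrite /truncated_payoff ge_min lexx.
have infW : has_inf W.
  split; last by exists m => w; exact: Wm.
  have /bcontP[_ [M cM]] := bcont_payoff point.
  exists M; apply: (WfW [fset point]%fset (fun=> 1)); rewrite ?big_seq_fset1//.
  by move=> b; rewrite big_seq_fset1 mul1r (le_trans (ler_norm _)).
exists (inf W); split.
(* The infimum is attained: [inf W + e] can be guaranteed for every [e > 0], and the resulting limit
   state is tight, hence represented by a strategy. *)
- have [D e e0|L [sL Lv]] := @states_finI_approx R A (B * nat)%type
    truncated_payoff (inf W).
    have [w [mu /P_sharpE muw] wv] := inf_adherent e0 infW.
    exists (integrals mu); split; first exact: integrals_states.
    move=> i _; rewrite total_ext_integrals; last exact: bcont_truncated_payoff.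
    exact: le_trans (muw i) (ltW wv).
  have [mu muE] := riesz_representation zA sL (tight_truncated_payoff sL Lv).
  exists mu; apply/P_sharpE => i; rewrite muE//; exact: bcont_truncated_payoff.
- have [|D p e p0 e0 p1|L [sL Lv]] := @minimax_states R B A (fun a b =>
    c (a, b)) (inf W).
  + exact: bcont_payoff.
  + apply: contrapT => /forallNP nb; suff : W (inf W - e).
      by move=> /(ge_inf infW.2); rewrite lerBrDr gerDl leNgt e0.
    apply: (WfW D p) => // b; rewrite leNgt; apply/negP => pb.
    by apply: (nb b); exact: ltW.
  have [nu nuE] := riesz_representation zB sL (tight_compactB sL).
  by exists nu; apply/P_flatE => a; rewrite nuE//; exact: bcont_payoff.
Qed.

(** Once both sets are nonempty at a common level, weak duality does the rest: [P_sharp_chat] and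
    [P_flat_chat] bound all guarantees by [v] and pin the payoff of optimal pairs to it. *)
Lemma game_theorem : exists v : R, lopsided_value c v /\
    [/\ (exists muA muB,
           [/\ solution c muA muB, P_sharp c v muA & P_flat c v muB]),
        ([/\ P_sharp c v !=set0, convex_strategies (P_sharp c v) &
             compact (P_sharp c v)] /\
         [/\ P_flat c v !=set0, convex_strategies (P_flat c v) &
             compact (P_flat c v)]) &
        forall muA muB,
          solution c muA muB <-> P_sharp c v muA /\ P_flat c v muB].
Proof.
have [v [[mu0 mu0v] [nu0 nu0v]]] := optimal_strategies.
(* [P_sharp] and [P_flat] are defined only at real levels, so an extended real is compared with [v]
   through the real numbers on one side of it. *)
have le_v (x : \bar R) : (forall w : R,
  (w%:E <= x)%E -> w <= v) -> (x <= v%:E)%E.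
  case: x => [x|h|_]; [by rewrite lee_fin; apply|exfalso|exact: leNye].
  by have := h (v + 1) (leey _); rewrite gerDl leNgt ltr01.
have ge_v (x : \bar R) : (forall w : R,
  (x <= w%:E)%E -> v <= w) -> (v%:E <= x)%E.
  case: x => [x|_|h]; [by rewrite lee_fin; apply|exact: leey|exfalso].
  by have := h (v - 1) (leNye _); rewrite lerBrDr gerDl leNgt ltr01.
have flat_le nu : (chat_flat c nu <= v%:E)%E.
  apply: le_v => w nuw; rewrite -lee_fin.
  exact: le_trans (P_flat_chat mu0 nuw) (P_sharp_chat nu mu0v).
have sharp_ge mu : (v%:E <= chat_sharp c mu)%E.
  apply: ge_v => w muw; rewrite -lee_fin.
  exact: le_trans (P_flat_chat mu nu0v) (P_sharp_chat nu0 muw).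
have psT mu : PS_A c mu by move=> nu; exact: chat_definedT.
have psT' nu : PS_B c nu by move=> mu; exact: chat_definedT.
have sol mu nu : solution c mu nu <-> P_sharp c v mu /\ P_flat c v nu.
  split=> [[_ _ s]|[muv nuv]].
    have sh : (chat_sharp c mu <= chat c mu nu)%E.
      by apply: ge_ereal_sup => _ [b _ <-]; case/andP: (s mu (point_mass R b)).
    have fl : (chat c mu nu <= chat_flat c nu)%E.
      by apply: le_ereal_inf_tmp => _ [a _ <-];
        case/andP: (s (point_mass R a) nu).
    split; first exact: le_trans sh (le_trans fl (flat_le nu)).
    exact: le_trans (sharp_ge mu) (le_trans sh fl).
  split => // mu' nu'; apply/andP; split.
    exact: le_trans (P_sharp_chat nu' muv) (P_flat_chat mu nuv).
  exact: le_trans (P_sharp_chat nu muv) (P_flat_chat mu' nuv).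
exists v; split; first split.
- apply/eqP; rewrite eq_le; apply/andP; split.
    by apply: le_trans nu0v _; apply: ereal_sup_ubound; exists nu0.
  by apply: ge_ereal_sup => _ [nu _ <-].
- apply/eqP; rewrite eq_le; apply/andP; split.
    by apply: le_ereal_inf_tmp => _ [mu _ <-].
  by apply: le_trans mu0v; apply: ereal_inf_lbound; exists mu0.
split.
- by exists mu0, nu0; split => //; apply/sol.
- split; split; [by exists mu0|exact: convex_P_sharp|exact: compact_P_sharp|
    by exists nu0|exact: convex_P_flat|exact: compact_P_flat].
- exact: sol.
Qed.

End game_value.

(** * Metric subspaces *)

Section subspace_topology.
Variables (R : realType) (X : metricType R) (A : set X) (A0 : A !=set0).
Local Notation S := (subspace_type A0).

Definition subspace_val (a : S) : X := set_val (a : A).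

Lemma subspace_val_inj : injective subspace_val.
Proof. exact: val_inj. Qed.

Lemma subspace_val_continuous : continuous subspace_val.
Proof. exact: (@initial_continuous A X set_val). Qed.

Lemma subspace_openP (G : set S) : open G ->
  exists2 W : set X, open W & G = subspace_val @^-1` W.
Proof. by move=> [W oW <-]; exists W. Qed.

Lemma subspace_nbhsP (a : S) (U : set S) : nbhs a U ->
  exists2 e : R, 0 < e & forall a',
    ball (subspace_val a) e (subspace_val a') -> U a'.
Proof.
rewrite nbhsE => -[G [/subspace_openP[W oW ->] aO] GU].
have /nbhs_ballP[e e0 eO] : nbhs (subspace_val a) W by exact: open_nbhs_nbhs.
by exists e => // a' aa'; apply/GU/eO.
Qed.

Lemma subspace_ball (a : S) (e : R) : 0 < e ->
  nbhs a [set a' | ball (subspace_val a) e (subspace_val a')].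
Proof.
by move=> e0; apply: subspace_val_continuous; exact: nbhsx_ballx.
Qed.

(** The function is the distance to the complement of an open set [W] of [X] that induces [G]; it is
    1-Lipschitz. *)
Lemma cozero_subspace : cozero_opens R S.
Proof.
move=> G /subspace_openP[W oW ->].
(* Without a point outside [W], the infimum defining the distance would range over the empty set. *)
have [WT|/existsNP[y0 Wy0]] := pselect (forall y, W y).
  exists (fun=> 1); split => //; first exact: cst_continuous.
  by move=> x; split => // _; exact: WT.
pose D x : set R := [set mdist x y | y in ~` W].
have D0 x : D x !=set0 by exists (mdist x y0); exists y0.
have Dlb x : has_lbound (D x) by exists 0 => _ [y _ <-]; exact: mdist_ge0.
pose d x := inf (D x).
have d0 x : 0 <= d x by apply: lb_le_inf => // _ [y _ <-]; exact: mdist_ge0.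
have dlip x y : d x <= mdist x y + d y.
  rewrite -lerBlDl; apply: lb_le_inf => // _ [z Oz <-]; rewrite lerBlDl.
  apply: le_trans (metric_triangle x y z).
  by apply: ge_inf => //; exists z.
have dcont : continuous d.
  move=> x; apply/cvgrPdist_lt => e e0; near=> y.
  have xy : mdist x y < e.
    have : ball x e y by near: y; exact: nbhsx_ballx.
    by rewrite ballEmdist.
  rewrite ltr_norml; apply/andP; split.
    by rewrite ltrBrDl ltrBlDr (le_lt_trans (dlip y x))// metric_sym addrC
      ltrD2l.
  by rewrite ltrBlDr (le_lt_trans (dlip x y))// ltrD2r.
exists (fun a => d (subspace_val a)); split.
- move=> a; apply: (@continuous_comp _ _ _ subspace_val d).
    exact: subspace_val_continuous.
  exact: dcont.
- by move=> a; exact: d0.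
- move=> a /=; split => [Oa|da].
    have /nbhs_ballP[e /= e0 eO] : nbhs (subspace_val a) W by exact:
      open_nbhs_nbhs.
    apply: (lt_le_trans e0); apply: lb_le_inf => // _ [y Oy <-].
    by rewrite leNgt; apply/negP => ay; apply: Oy; apply: eO;
      rewrite ballEmdist.
  apply: contrapT => Oa; move: da; rewrite ltNge => /negP; apply; rewrite /= /d.
  by apply: ge_inf => //; exists (subspace_val a) => //; exact: mdistxx.
Unshelve. all: by end_near. Qed.

(** Either [a] is a cluster point, or some set of the filter avoids a neighbourhood of [a] and
    leaves only finitely many terms. Such sets serve as the compact [C] in sup-compactness. *)
Lemma compact_subspace_seq (a : S) (u : nat -> S) :
  (forall n, ball (subspace_val a) n.+1%:R^-1 (subspace_val (u n))) ->
  compact (a |` range u).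
Proof.
move=> ua F PF FC; have [acl|/existsNP[P /existsNP[U]]] := pselect (cluster F
  a).
  by exists a; split => //; left.
move=> /not_implyP[FP /not_implyP[aU PU]].
have [e e0 eU] := subspace_nbhsP aU.
pose N := Num.truncn e^-1.
have FN : F (u @` `I_N).
  apply: filterS (filterI FC FP) => x [[->|[n _ <-]] Px].
    by exfalso; apply: PU; exists a; split => //; exact: nbhs_singleton.
  exists n => //=; rewrite ltnNge; apply/negP => Nn; apply: PU; exists (u n);
    split => //.
  apply: eU; apply: le_ball (ua n).
  rewrite invf_ple ?posrE//; apply: (@le_trans _ _ N.+1%:R);
    first by rewrite ltW// truncnS_gt.
  by rewrite ler_nat.
have [x [[n _ <-] xcl]] := finite_compact (finite_image u (finite_II N)) PF FN.
by exists (u n); split => //; right; exists n.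
Qed.

Lemma closed_subspace_seq (P : set S) :
  (forall (a : S) (u : nat -> S),
    (forall n, ball (subspace_val a) n.+1%:R^-1 (subspace_val (u n))) ->
    (forall n, P (u n)) -> P a) -> closed P.
Proof.
move=> seqP a aP.
have pick n : exists a',
  P a' /\ ball (subspace_val a) n.+1%:R^-1 (subspace_val a').
  have n0 : 0 < n.+1%:R^-1 :> R by rewrite invr_gt0.
  by have [a' []] := aP _ (subspace_ball a n0); exists a'.
by apply: (seqP a (fun n => sval (cid (pick n)))) => n;
  have [] := svalP (cid (pick n)).
Qed.

Lemma metric_ball_open (x : X) (r : R) : open (ball x r).
Proof.
rewrite openE => y; rewrite ballEmdist/= => xy; apply/nbhs_ballP.
exists (r - mdist x y) => /=; first by rewrite subr_gt0.
move=> z; rewrite !ballEmdist/= => yz.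
by rewrite (le_lt_trans (metric_triangle x y z))// -ltrBDl.
Qed.

(** The base consists of traces of balls centred in the dense subset of [X], whose points need not
    lie in [A]; it is indexed by codes of pairs [(f y, n)]. *)
Lemma subspace_countable_base : (exists2 D : set X, countable D & dense D) ->
  exists2 V : nat -> set S, (forall n, open (V n)) &
    forall a U, nbhs a U -> exists n, V n a /\ V n `<=` U.
Proof.
move=> [D /countable_injP[f finj] dD].
pose V (i n : nat) : set S :=
  [set a | exists y, [/\ D y, f y = i & ball y n.+1%:R^-1 (subspace_val a)]].
exists (fun k => if choice.unpickle k : option (nat * nat) is Some (i,
  n) then V i n else set0) => [k|a U /subspace_nbhsP[e e0 eU]].
  case: choice.unpickle => [[i n]|]; last exact: open0.
  rewrite openE => a [y [Dy fy ya]].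
  have yn : nbhs (subspace_val a) (ball y n.+1%:R^-1).
    by apply: open_nbhs_nbhs; split => //; exact: metric_ball_open.
  have : nbhs a [set a' | ball y n.+1%:R^-1 (subspace_val a')].
    exact: (@subspace_val_continuous a _ yn).
  by apply: (@filterS _ (nbhs a)) => a' ya'; exists y.
pose n := Num.truncn (2 / e); have n0 : 0 < n.+1%:R^-1 :> R by rewrite invr_gt0.
have ne : n.+1%:R^-1 + n.+1%:R^-1 <= e.
  rewrite -mulr2n -[leLHS]mulr_natl ler_pdivrMr// mulrC -ler_pdivrMr//.
  by rewrite ltW// truncnS_gt.
have [y [ay Dy]] : (ball (subspace_val a) n.+1%:R^-1)^° `&` D !=set0.
  apply: dD; last exact: open_interior.
  by exists (subspace_val a); exact: nbhsx_ballx.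
have {}ay := interior_subset ay.
exists (choice.pickle (f y, n)); rewrite choice.pickleK; split.
  by exists y; split => //; exact: ball_sym.
move=> a' [y' [Dy' fy' ya']]; apply: eU.
have yy' : y' = y by apply: finj; rewrite ?inE.
rewrite yy' in ya'; exact: le_ball ne _ (ball_triangle ay ya').
Qed.

End subspace_topology.

(** * Open sets of the product and the product sigma-algebra *)

Section product_sets.
Variables (R : realType) (A B : ptopologicalType).

(** For each [n], an interior gives the largest open set of [a] whose rectangle over [V n] stays in
    [G]; since the [V n] form a base, these countably many rectangles fill [G]. *)
Lemma open_product_measurable (V : nat -> set B) :
  (forall n, open (V n)) ->
  (forall b U, nbhs b U -> exists n, V n b /\ V n `<=` U) ->
  forall G : set (A * B),
    open G -> measurable (G : set (borel A * borel B)%type).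
Proof.
move=> oV base G oG.
have -> : G = \bigcup_n ([set a | forall b, V n b -> G (a, b)]^° `*` V n).
  apply/seteqP; split => [[a b] Gab|[a b] [n _ [/interior_subset aG /= Vb]]];
    last exact: aG.
  have [[P Q] /= [aP bQ] PQG] : nbhs (a, b) G by exact: open_nbhs_nbhs.
  have [n [Vb VQ]] := base b Q bQ; exists n => //; split => //=.
  by apply: filterS aP => a' Pa' b' /VQ Qb'; exact: (PQG (a', b')).
apply: (@bigcupT_measurable _ (borel A * borel B)%type) => n.
apply: (@measurableX _ _ (borel A) (borel B)).
  by apply: sub_sigma_algebra; exact: open_interior.
by apply: sub_sigma_algebra; exact: oV.
Qed.

Lemma product_semicontinuous_measurable (V : nat -> set B) (f : A * B -> R) :
  (forall n, open (V n)) ->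
  (forall b U, nbhs b U -> exists n, V n b /\ V n `<=` U) ->
  (forall r, open [set z | r < f z]) ->
  measurable_fun setT (f : (borel A * borel B)%type -> R).
Proof.
move=> oV base of_; apply: (measurability _ (RGenOInfty.measurableE R)).
move=> _ [_ [r ->] <-]; rewrite setTI.
rewrite (_ : _ @^-1` _ = [set z | r < f z]).
  exact: (open_product_measurable oV base).
by apply/seteqP; split => x /=; rewrite in_itv/= andbT.
Qed.

End product_sets.

Section topological_preliminaries.

Lemma cluster_continuous (T U : topologicalType) (f : T -> U) (p q : T) :
  hausdorff_space U -> continuous f -> cluster (nbhs p) q -> f p = f q.
Proof.
move=> hU cf pq; apply: hU => P Q pP qQ.
have [x [Px Qx]] := pq _ _ (cf p _ pP) (cf q _ qQ).
by exists (f x).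
Qed.

Lemma closed_levels_continuous (R : realType) (T : topologicalType) (f : T ->
  R) :
  (forall r, closed [set x | f x <= r]) -> (forall r,
    closed [set x | r <= f x]) ->
  continuous f.
Proof.
move=> fle fge x; apply/cvgrPdist_lt => e e0.
have lo : nbhs x [set y | f x - e < f y].
  apply: open_nbhs_nbhs; split; last by rewrite /= ltrBlDr ltrDl.
  rewrite (_ : [set y | _] = ~` [set y | f y <= f x - e]);
    first by rewrite openC.
  by apply/seteqP; split => y /=; rewrite ltNge => /negP.
have hi : nbhs x [set y | f y < f x + e].
  apply: open_nbhs_nbhs; split; last by rewrite /= ltrDl.
  rewrite (_ : [set y | _] = ~` [set y | f x + e <= f y]);
    first by rewrite openC.
  by apply/seteqP; split => y /=; rewrite ltNge => /negP.
near=> y; have : f x - e < f y by near: y.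
have : f y < f x + e by near: y.
by rewrite ltr_norml => ? ?; apply/andP; split; lra.
Unshelve. all: by end_near. Qed.

Lemma closed_section (U V : topologicalType) (P : set (U * V)) (u : U) :
  closed P -> closed [set v | P (u, v)].
Proof.
move=> cP; apply: (@closed_comp _ _ (fun v => (u, v)) P) => // v _.
by apply: cvg_pair; [exact: cvg_cst|exact: cvg_id].
Qed.

Lemma closed_swap (U V : topologicalType) (P : set (U * V)) :
  closed P -> closed [set z : V * U | P (z.2, z.1)].
Proof.
move=> cP; apply: (@closed_comp _ _ (fun z : V * U => (z.2, z.1)) P) => // z _.
by apply: cvg_pair; [exact: cvg_snd|exact: cvg_fst].
Qed.

Lemma compact_projection (U V : topologicalType) (P : set (U * V)) :
  compact P -> compact [set v | exists u, P (u, v)].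
Proof.
move=> cP; have -> : [set v | exists u, P (u, v)] = snd @` P.
  by apply/seteqP; split => [v [u Puv]|v [[u w] Puw <-]];
    [exists (u, v)|exists u].
by apply: continuous_compact cP; apply: continuous_subspaceT => z;
  exact: cvg_snd.
Qed.

Lemma hausdorff_subspace_prod (R : realType) (X Y : metricType R) (A : set X)
    (B : set Y) (A0 : A !=set0) (B0 : B !=set0) :
  hausdorff_space (subspace_type A0 * subspace_type B0)%type.
Proof.
move=> p q pq; rewrite (surjective_pairing p) (surjective_pairing q);
  congr (_, _).
- apply: subspace_val_inj.
  apply: (@cluster_continuous _ _ (fun z => subspace_val z.1) p q) pq.
    exact: metric_hausdorff.
  move=> z; apply: (@continuous_comp _ _ _ fst (@subspace_val _ _ _ A0)).
    exact: cvg_fst.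
  exact: subspace_val_continuous.
- apply: subspace_val_inj.
  apply: (@cluster_continuous _ _ (fun z => subspace_val z.2) p q) pq.
    exact: metric_hausdorff.
  move=> z; apply: (@continuous_comp _ _ _ snd (@subspace_val _ _ _ B0)).
    exact: cvg_snd.
  exact: subspace_val_continuous.
Qed.

End topological_preliminaries.

Theorem theorem20 (R : realType) (X Y : metricType R) (A : set X) (B : set Y)
    (A0 : A !=set0) (B0 : B !=set0)
    (c : subspace_type A0 * subspace_type B0 -> R)
    (game : is_game c)
    (c_inf : K_inf_compact
       (fun z : subspace_type B0 * subspace_type A0 => (c (z.2, z.1))%:E))
    (c_sup : K_sup_compact
       (fun z : subspace_type A0 * subspace_type B0 => (c z)%:E))
    (c_bounded_below : has_lbound (range c)) :
  exists v : R, lopsided_value c v /\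
    [/\ (exists muA muB,
           [/\ solution c muA muB, P_sharp c v muA & P_flat c v muB]),
        ([/\ P_sharp c v !=set0, convex_strategies (P_sharp c v) &
             compact (P_sharp c v)] /\
         [/\ P_flat c v !=set0, convex_strategies (P_flat c v) &
             compact (P_flat c v)]) &
        forall muA muB,
          solution c muA muB <-> P_sharp c v muA /\ P_flat c v muB].
Proof.
have [m0 m0c] := c_bounded_below.
pose m := Num.min m0 0.
have m_le0 : m <= 0 by rewrite /m ge_min lexx orbT.
have mc z : m <= c z by rewrite /m ge_min m0c//; exists z.
have infC C r : C !=set0 -> compact C ->
    compact [set z : subspace_type B0 * subspace_type A0 | C z.1 /\ c (z.2,
      z.1) <= r].
  by move=> C0 cC; have := c_inf C r C0 cC.
have supC C r : C !=set0 -> compact C ->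
    compact [set z : subspace_type A0 * subspace_type B0 | C z.1 /\ r <= c z].
  move=> C0 cC; have := c_sup C (- r) C0 cC; congr compact.
  by apply/seteqP; split => z /=; rewrite lee_fin lerN2.
(* As [m] is a lower bound of [c], the level set over a single point [a] projects onto all of B. *)
have compactB : compact [set: subspace_type B0].
  have := compact_projection (supC [set point] m (ex_intro _ point erefl)
    (@compact_set1 _ _)).
  congr compact; apply/seteqP; split => // b _; exists point; split => //=.
have compactA : exists b, forall r, compact [set a | c (a, b) <= r].
  exists point => r.
  have := compact_projection (infC [set point] r (ex_intro _ point erefl)
    (@compact_set1 _ _)).
  congr compact; apply/seteqP; split => [a [b /= [-> //]]|a ac].
  by exists point.
(* B being compact, it may itself serve as [C], which gives joint lower semicontinuity. *)
have c_le r : closed [set z | c z <= r].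
  have := compact_closed (@hausdorff_subspace_prod _ _ _ _ _ B0 A0)
    (infC setT r (ex_intro _ point I) compactB).
  move=> /closed_swap; congr closed.
  by apply/seteqP; split => -[a b] /=; [case|].
(* Upper level sets are controlled over compact sets of [a]: a single point is enough for [cB], a
   convergent sequence with its limit for [cA]. *)
have c_ge (C : set (subspace_type A0)) r : C !=set0 -> compact C ->
    closed [set z | C z.1 /\ r <= c z].
  by move=> C0 cC; apply: compact_closed (supC C r C0 cC);
    exact: hausdorff_subspace_prod.
have cB a : continuous (fun b => c (a, b)).
  apply: closed_levels_continuous => r;
    first exact: (@closed_section _ _ _ a (c_le r)).
  have := @closed_section _ _ _ a (c_ge [set a] r (ex_intro _ a erefl)
    (@compact_set1 _ _)).
  by congr closed; apply/seteqP; split => b /=; [case|].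
have cA b : continuous (fun a => c (a, b)).
  apply: closed_levels_continuous => r.
    exact: (@closed_section _ _ _ b (closed_swap (c_le r))).
  apply: closed_subspace_seq => a u ua ru.
  have cu := compact_subspace_seq ua.
  have : closed [set a' | (a |` range u) a' /\ r <= c (a', b)].
    apply: (@closed_section _ _ _ b (closed_swap (c_ge (a |` range u) r _ cu))).
    by exists a; left.
  move=> cl; apply: (proj2 (cl a _)) => U /subspace_nbhsP[e e0 eU];
    exists (u (Num.truncn e^-1)); split.
    by split; [right; exists (Num.truncn e^-1)|exact: ru].
  apply: eU; apply: le_ball (ua _).
  by rewrite invf_ple ?posrE// ltW// truncnS_gt.
have [_ [[_ sepY] _] _ _ _] := game.
have [V oV base] := subspace_countable_base B0 sepY.
apply: (@game_theorem _ _ _ c m) => //; try exact: cozero_subspace.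
(* Tonelli's theorem asks for measurability with respect to the product sigma-algebra; it comes from
   lower semicontinuity and the countable base of B. *)
apply: product_semicontinuous_measurable oV base _ => r.
rewrite (_ : [set z | _] = ~` [set z | c z <= r]); first by rewrite openC.
by apply/seteqP; split => y /=; rewrite ltNge => /negP.
Qed.
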